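(* Let $d\ge1$ and $\alpha\in(0,1)$. The following are equivalent: (a) for every $d+1$ absolutely continuous probability measures $\mu_0,\mu_1,\dots,\mu_d$ on $\mathbb R^d$ there exists a convex set $C\subset\mathbb R^d$ with $\mu_0(C)=\mu_1(C)=\dots=\mu_d(C)=\alpha$; (b) $\alpha=1/m$ for some positive integer $m$. *)

(* Defs.v *)
From HB Require Import structures.
From mathcomp Require Import all_boot all_order all_algebra.
From mathcomp Require Import all_classical all_reals all_analysis.
Set Implicit Arguments. Unset Strict Implicit. Unset Printing Implicit Defensive.
Import Order.TTheory GRing.Theory Num.Theory.
Local Open Scope classical_set_scope.
Local Open Scope ring_scope.

(* R^d is represented by d.-tuple R, equipped (by MathComp-Analysis) with the
   product sigma-algebra of Borel sets, i.e. the Borel sigma-algebra of R^d. *)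

Definition box (R : realType) (d : nat) (a b : d.-tuple R) : set (d.-tuple R) :=
  [set x | forall i : 'I_d, tnth a i <= tnth x i <= tnth b i].

Definition box_vol (R : realType) (d : nat) (a b : d.-tuple R) : R :=
  \prod_(i < d) Num.max 0 (tnth b i - tnth a i).

Definition lebesgue_null (R : realType) (d : nat) (N : set (d.-tuple R)) : Prop :=
  forall eps : R, 0 < eps ->
    exists a b : nat -> d.-tuple R,
      N `<=` \bigcup_k box (a k) (b k) /\
      forall n : nat, \sum_(k < n) box_vol (a k) (b k) <= eps.

Definition abs_cont (R : realType) (d : nat) (mu : set (d.-tuple R) -> \bar R) : Prop :=
  forall N : set (d.-tuple R), measurable N -> lebesgue_null N -> mu N = 0%E.

Definition cvx_comb (R : realType) (d : nat) (t : R) (x y : d.-tuple R) : d.-tuple R :=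
  [tuple t * tnth x i + (1 - t) * tnth y i | i < d].

Definition is_convex_set (R : realType) (d : nat) (C : set (d.-tuple R)) : Prop :=
  forall x y t, C x -> C y -> 0 <= t <= 1 -> C (cvx_comb t x y).

(* Main.v *)
(**
Let alpha = 1/m. Restricting the measures to the convex sets already found, one prime factor of m at
a time, reduces the claim to m = p prime. Let f_1, .., f_p be the quadratic polynomials
t_i + sum_k y_i^k x_k + y_i^d |x|^2, where t_i depends on y in such a way that the f_i are always
pairwise distinct, and cut R^d into the cells where one f_i exceeds all others. The cell whose f_i has
the smallest |x|^2-coefficient is defined by concave inequalities, hence convex. So it suffices to
find y in ([0,1]^p)^(d+1) such that every mu_k gives the same mass to all p cells. On a fine grid,
label y in block k by a cell of largest mu_k-mass; by compactness, it is enough to find a small simplex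
in which every label occurs in every block. Such simplices support the cochain with values in F_p
which is the cup product, over the blocks, of the determinant of the labels and of the coboundary of
the indicator of a half space. It is a cocycle, so on a prism that joins the labelling to a reference
labelling its sums over bottom and top differ by the sum over the side walls. On a wall some block has
a wide gap, which singles out a proper nonempty subset of its p coordinates; since the labelling
commutes with swaps of adjacent coordinates that are far apart, the contribution of a subset
depends only on its cardinality k, and p divides the number of subsets of size k. The reference
labelling is chosen so that exactly one simplex contributes.

Conversely let 1/(n+1) < alpha < 1/n. Take mu_1, .., mu_d uniform on [0,1] times small cubes around the
vertices of a simplex in R^(d-1), and mu_0 the average of n uniform measures on short intervals that
start at the points j/(n+1), times a small cube inside the simplex. A convex set of mass alpha for
mu_1, .., mu_d contains, over some point of each vertex cube, two points at distance slightly more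
than 1/(n+1). By convexity it contains such a segment over every point of the inner cube, hence one
of the n intervals there, so its mu_0-mass is at least 1/n > alpha.
*)
Require Import Defs.
From HB Require Import structures.
From mathcomp Require Import all_boot all_order all_algebra all_fingroup.
From mathcomp Require Import ring lra zify.
From mathcomp Require Import boolp.
Set Implicit Arguments. Unset Strict Implicit. Unset Printing Implicit Defensive.
Import Order.TTheory GRing.Theory Num.Theory.
Local Open Scope ring_scope.

(** * Simplicial cochains and Kuhn triangulations *)

Section Cochains.
Variables (V : Type) (F : comNzRingType).
Implicit Types (a b : (nat -> V) -> F) (v : nat -> V).

Definition tailseq n v := fun i => v (n + i)%N.
Definition delseq j v := fun i => v (bump j i).

(* Cochains are functions of infinite vertex sequences; [reads n] makes them [n]-cochains. *)
Definition reads n a :=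
  forall v v', (forall i, (i <= n)%N -> v i = v' i) -> a v = a v'.

Definition cobound n a v := \sum_(j < n.+2) (-1) ^+ j * a (delseq j v).

Definition cup m a b v := a v * b (tailseq m v).

Definition cocycle n a := reads n a /\ forall v, cobound n a v = 0.

(** Graded Leibniz rule. The last face of the first factor and the first face of the second both
    give [a v * b (tailseq m.+1 v)], with opposite signs, and cancel; the remaining terms match the
    faces of the product one by one. *)
Lemma cobound_cup m n a b v : reads m a -> reads n b ->
  cobound (m + n) (cup m a b) v =
  cobound m a v * b (tailseq m.+1 v) + (-1) ^+ m * a v * cobound n b (tailseq m v).
Proof.
move=> ra rb; rewrite /cobound [X in _ = X * _ + _]big_ord_recr/= mulrDl.
have -> : a (delseq m.+1 v) = a v.
  by apply: ra => i im; rewrite /delseq /bump ltnNge im.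
rewrite [X in _ = _ + _ * X]big_ord_recl/= expr0 mul1r mulrDr.
have -> : b (delseq 0 (tailseq m v)) = b (tailseq m.+1 v).
  by apply: rb => i im; rewrite /delseq /tailseq /bump /= add1n addnS.
set X := \sum_(i < m.+1) _; set Y := \sum_(i < n.+1) _.
rewrite [RHS]addrA -[X in _ = X + _]addrA.
have -> : (-1) ^+ m.+1 * a v * b (tailseq m.+1 v) +
   (-1) ^+ m * a v * b (tailseq m.+1 v) = 0.
  by rewrite exprS mulN1r !mulNr addNr.
rewrite addr0; have -> : ((m + n).+2 = m.+1 + n.+1)%N by rewrite addnS addSn.
rewrite big_split_ord/= /X /Y mulr_suml mulr_sumr; congr (_ + _).
  apply: eq_bigr => j _; rewrite /cup -mulrA; congr (_ * (_ * _)).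
  apply: rb => i _; rewrite /tailseq /delseq /bump (leq_trans (_ : j <= m)%N) ?add1n//.
    by rewrite -ltnS ltn_ord.
  exact: leq_addr.
apply: eq_bigr => j _; rewrite /cup.
have -> : a (delseq (m.+1 + j) v) = a v.
  by apply: ra => i im; rewrite /delseq /bump leqNgt ltnS (leq_trans im) ?leq_addr.
have -> : b (tailseq m (delseq (m.+1 + j) v)) = b (delseq (bump 0 j) (tailseq m v)).
  apply: rb => i _; rewrite /tailseq /delseq /bump/= addnCA; congr (v (m + (nat_of_bool _ + _)))%N.
  by rewrite addSnnS add1n leq_add2l.
rewrite /bump/= add1n mulrCA !mulrA addSnnS exprD; congr (_ * _).
by rewrite mulrA [a v * _]mulrC.
Qed.

Lemma cup_cocycle m n a b : cocycle m a -> cocycle n b -> cocycle (m + n) (cup m a b).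
Proof.
move=> [ra ca] [rb cb]; split=> [v v' E|v].
  rewrite /cup (ra _ v') => [|i im]; last by apply: E; rewrite (leq_trans im)// leq_addr.
  by congr (_ * _); apply: rb => i im; apply: E; rewrite leq_add2l.
by rewrite cobound_cup// ca cb mul0r mulr0 addr0.
Qed.

(** An iterated cup product; consecutive windows share one vertex. The empty product is the constant
    1, whose coboundary in degree 0 is [1 - 1]. *)
Lemma cocycle_prod_windows p (b : nat -> (nat -> V) -> F) n :
  (forall k, cocycle p (b k)) ->
  cocycle (n * p) (fun v => \prod_(k < n) b k (tailseq (k * p) v)).
Proof.
move=> cb; elim: n => [|n [rn cn]].
  split=> [v v' _|v]; first by rewrite !big_ord0.
  by rewrite /cobound !big_ord_recl !big_ord0 /= expr0 expr1 mul1r mulN1r addr0 subrr.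
have [r c] := cup_cocycle (conj rn cn) (cb n).
rewrite mulSn addnC; split=> [v v' E|v].
  by rewrite !big_ord_recr/=; apply: r.
by rewrite -[RHS](c v); apply: eq_bigr => j _; rewrite big_ord_recr.
Qed.

End Cochains.

Section Kuhn.
Variables (F : comNzRingType) (q B : nat) (N : 'I_q.+1 -> nat).
Hypothesis NB : forall c, (N c <= B.+1)%N.
Notation simplex := ({ffun 'I_q.+1 -> 'I_B.+1} * 'S_q.+1)%type.
Implicit Types (s : simplex).

(* The pair [(g, pi)] encodes the simplex that starts at [g] and increments the coordinates in the
   order prescribed by [pi]. *)
Definition kuhn_vertex s (j : nat) : 'I_q.+1 -> nat :=
  fun c => (s.1 c + (s.2 c < j))%N.
Definition in_box s := [forall c, (s.1 c < N c)%N].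
Definition first_dir s := (s.2)^-1%g ord0.
Definition last_dir s := (s.2)^-1%g ord_max.

Definition rot_perm : 'S_q.+1 := lift_perm ord0 ord_max 1.
(** The neighbour across the facet opposite to the first vertex: that vertex is dropped, and its
    direction is used again as the last one. On overflow [inord] yields 0, which the positivity
    condition in [pushP] rules out. *)
Let push s : simplex :=
  ([ffun c => if c == first_dir s then inord (s.1 c).+1 else s.1 c], (s.2 * rot_perm)%g).
Let pull s : simplex :=
  ([ffun c => if c == last_dir s then inord (s.1 c).-1 else s.1 c], (s.2 * rot_perm^-1)%g).

Lemma rot_perm_val (i : 'I_q.+1) : rot_perm i = (if i == 0 :> nat then q else i.-1) :> nat.
Proof.
case: (unliftP ord0 i) => [j ->|->]; last by rewrite lift_perm_id.
by rewrite lift_perm_lift perm1 /= /bump leqNgt ltn_ord.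
Qed.

Let simplexP s s' : s.1 = s'.1 -> s.2 = s'.2 -> s = s'.
Proof. by case: s s' => [g p] [g' p'] /= -> ->. Qed.

Let last_push s : last_dir (push s) = first_dir s.
Proof.
rewrite /last_dir /first_dir /push/= invMg permM; congr (_ _).
by apply: (@perm_inj _ rot_perm); rewrite permKV lift_perm_id.
Qed.

Let first_pull s : first_dir (pull s) = last_dir s.
Proof.
rewrite /last_dir /first_dir /push/= invMg permM invgK; congr (_ _).
by rewrite lift_perm_id.
Qed.

Let pushP s : in_box (push s) && (0 < (push s).1 (last_dir (push s)))%N && (pull (push s) == s)
  = in_box s && ((s.1 (first_dir s)).+1 < N (first_dir s))%N.
Proof.
rewrite last_push; apply/andP/andP => [[/andP[/forallP b gt0] /eqP sK]|[/forallP b lt]].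
  have e (c : 'I_q.+1) : c != first_dir s -> (s.1 c < N c)%N.
    by move=> cs; have := b c; rewrite ffunE (negbTE cs).
  have := b (first_dir s); move: gt0; rewrite ffunE eqxx /inord val_insubd.
  case: (ltnP (s.1 (first_dir s)).+1 B.+1) => // lt _ lt'.
  split=> //; apply/forallP => c.
  by have [->|/e//] := eqVneq c (first_dir s); apply: ltnW.
have lt' : ((s.1 (first_dir s)).+1 < B.+1)%N by rewrite (leq_trans lt).
rewrite ffunE eqxx inordK//=; split.
  rewrite andbT; apply/forallP => c; rewrite ffunE.
  by case: eqP => [->|_]; rewrite ?inordK.
apply/eqP/simplexP; last by rewrite /= mulgK.
apply/ffunP => c; rewrite ffunE last_push ffunE; case: eqP => // ->.
by rewrite (inordK lt') inord_val.
Qed.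

Let pullK s : in_box s && (0 < s.1 (last_dir s))%N -> push (pull s) = s.
Proof.
move=> /andP[_ gt0]; apply: simplexP; last by rewrite /= mulgKV.
apply/ffunP => c; rewrite ffunE first_pull ffunE; case: eqP => // ->.
have lt : ((s.1 (last_dir s)).-1 < B.+1)%N by rewrite (leq_ltn_trans (leq_pred _)).
by rewrite (inordK lt) prednK// inord_val.
Qed.

Let push_vertex s j : (j <= q)%N -> in_box s -> ((s.1 (first_dir s)).+1 < N (first_dir s))%N ->
  kuhn_vertex (push s) j =1 kuhn_vertex s j.+1.
Proof.
move=> jq bs lt c; rewrite /kuhn_vertex /push/= ffunE permM rot_perm_val.
case: eqP => [->|/eqP cs].
  rewrite /first_dir permKV/= -/(first_dir s) inordK ?(leq_trans lt)//.
  by rewrite ltnNge jq addn0 addn1.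
have -> : (s.2 c == 0 :> nat) = false.
  by apply: contra_neqF cs => /eqP s0; rewrite /first_dir; apply: (@perm_inj _ s.2); rewrite permKV; apply: val_inj.
have : (0 < s.2 c)%N.
  rewrite lt0n; apply: contra_neqN cs => /eqP s0.
  by apply: (@perm_inj _ s.2); rewrite permKV; apply: val_inj.
by case: (nat_of_ord _).
Qed.

(** Stokes formula. A facet omitting an inner vertex is shared by two simplices with the same start,
    and one omitting the first vertex of [s] is the one omitting the last vertex of [push s]. These
    pairs cancel; the rest lies on the boundary of the box. *)
Lemma kuhn_boundary (a : (nat -> 'I_q.+1 -> nat) -> F) :
  (forall v v', (forall i, (i <= q)%N -> v i =1 v' i) -> a v = a v') ->
  \sum_(s : simplex | in_box s) (-1) ^+ s.2 * cobound q a (kuhn_vertex s) =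
  \sum_(s | in_box s && ((s.1 (first_dir s)).+1 == N (first_dir s)))
     (-1) ^+ s.2 * a (fun j => kuhn_vertex s j.+1)
  + (-1) ^+ q.+1 * \sum_(s : simplex | in_box s && (s.1 (last_dir s) == 0 :> nat))
     (-1) ^+ s.2 * a (kuhn_vertex s).
Proof.
move=> ra.
(* Omitting an inner vertex forgets the order of the two increments around it, so exchanging them
   pairs the simplices with opposite signs. *)
have mid (j : 'I_q) : \sum_(s : simplex | in_box s) (-1) ^+ s.2 * ((-1) ^+ (bump 0 j)
    * a (delseq (bump 0 j) (kuhn_vertex s))) = 0.
  pose t := tperm (widen_ord (leqnSn q) j) (lift ord0 j).
  pose sw (s : simplex) : simplex := (s.1, s.2 * t)%g.
  have swK : involutive sw by move=> [g s]; rewrite /sw/= -mulgA tperm2 mulg1.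
  have oddsw s : odd_perm (sw s).2 = ~~ odd_perm s.2.
    rewrite /sw/= odd_permM odd_tperm.
    have -> : widen_ord (leqnSn q) j != lift ord0 j.
      by rewrite -val_eqE/= /bump/= add1n neq_ltn ltnSn.
    by rewrite addbT.
  rewrite (bigID (fun s : simplex => odd_perm s.2))/= (reindex_inj (inv_inj swK)).
  rewrite [X in X + _](eq_bigl (fun s => in_box s && ~~ odd_perm s.2)) ; last by move=> s; rewrite oddsw.
  rewrite -big_split/=; apply: big1 => s _.
  rewrite oddsw signrN mulNr.
  suff -> : a (delseq (bump 0 j) (kuhn_vertex (sw s))) =
            a (delseq (bump 0 j) (kuhn_vertex s)) by rewrite addNr.
  apply: ra => i _ c; rewrite /delseq /kuhn_vertex/= permM; congr (_ + nat_of_bool _)%N.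
  have nj : bump (bump 0 j) i != bump 0 j by rewrite eq_sym neq_bump.
  have E : (bump 0 j < bump (bump 0 j) i)%N = (j < bump (bump 0 j) i)%N.
    by rewrite [RHS]leq_eqVlt; move: nj; rewrite {1 4}/bump/= add1n eq_sym => /negbTE ->.
  by rewrite /t; case: tpermP => [->|->|//].
rewrite /cobound.
under eq_bigr do rewrite big_ord_recl/= big_ord_recr/= !mulrDr mulr_sumr.
rewrite big_split/= big_split/= exchange_big/= [X in _ + (X + _)]big1 => [|j _]; last exact: mid.
rewrite add0r mulr_sumr.
rewrite (bigID (fun s => (s.1 (first_dir s)).+1 == N (first_dir s)))/= -addrA.
congr (_ + _).
  apply: eq_bigr => s _; rewrite expr0 mul1r; congr (_ * _).
rewrite [X in _ + X](bigID (fun s => s.1 (last_dir s) == 0 :> nat))/= addrCA -[RHS]addr0.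
congr (_ + _).
  apply: eq_bigr => s _; rewrite mulrCA; congr (_ * (_ * _)).
  by apply: ra => i iq c; rewrite /delseq /bump/= add1n ltnNge iq.
under [X in _ + X]eq_bigl do rewrite -lt0n.
rewrite [X in _ + X](reindex_onto push pull)/=; last exact: pullK.
under [X in _ + X]eq_bigl do rewrite pushP.
under [X in X + _]eq_bigl => s.
  rewrite (_ : _ && _ = in_box s && ((s.1 (first_dir s)).+1 < N (first_dir s))%N); last first.
    case: (boolP (in_box s)) => //= /forallP /(_ (first_dir s)).
    by rewrite [in RHS]ltn_neqAle => ->; rewrite andbT.
  over.
rewrite -big_split/=; apply: big1 => s /andP[bs lt].
(* The cycle [rot_perm] has sign [(-1) ^+ q] and the last face carries [(-1) ^+ q.+1], so the two
   contributions of the common facet are opposite. *)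
rewrite odd_permM odd_lift_perm odd_perm1/= addbF.
have -> : a (delseq 0 (kuhn_vertex s)) = a (kuhn_vertex (push s)).
  by apply: ra => i iq c; rewrite push_vertex// /delseq /bump/= add1n.
have -> : a (delseq (bump 0 q) (kuhn_vertex (push s))) = a (kuhn_vertex (push s)).
  by apply: ra => i iq c; rewrite /delseq /bump/= add1n ltnNge iq.
rewrite expr0 mul1r signr_addb mulrACA.
rewrite signr_odd /bump/= add1n exprS mulN1r mulrN mulNr -mulrA.
by rewrite [X in _ - _ * X]mulrA -expr2 sqrr_sign mul1r subrr.
Qed.

End Kuhn.

(** * Label determinants and adjacent swaps *)

Section LabelDeterminant.
Variable F : fieldType.

Definition label_mx m n (l : 'I_m -> 'I_n) : 'M[F]_(m, n) := \matrix_(i, j) (l i == j)%:R.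
(** The sign of [l] if [l] is a permutation, and zero otherwise. Written as a determinant, its
    cocycle identity becomes a Laplace expansion. *)
Definition label_det n (l : 'I_n -> 'I_n) : F := \det (label_mx l).

Lemma label_det_perm n (s : 'S_n) (l : 'I_n -> 'I_n) :
  label_det (fun i => s (l i)) = (-1) ^+ s * label_det l.
Proof.
rewrite /label_det -det_perm mulrC -det_mulmx; congr (\det _).
apply/matrixP => i j; rewrite !mxE (bigD1 (l i))//= big1 => [|k /negbTE ki].
  by rewrite !mxE eqxx mul1r addr0.
by rewrite !mxE eq_sym ki mul0r.
Qed.

Lemma label_det_inj n (l : 'I_n -> 'I_n) : label_det l != 0 -> injective l.
Proof.
move=> nz i j lij; apply/eqP; apply: contraNT nz => ij.
by apply/eqP/(determinant_alternate ij) => k; rewrite !mxE lij.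
Qed.

Lemma label_det_neq0 n (l : 'I_n -> 'I_n) : injective l -> label_det l != 0.
Proof.
move=> il; have -> : label_det l = label_det (fun i => perm il (id i)).
  by congr (\det _); apply/matrixP => i j; rewrite !mxE permE.
rewrite label_det_perm mulf_neq0 ?signr_eq0//.
have -> : label_det id = 1%R; last exact: oner_neq0.
by move=> m; rewrite /label_det -[RHS](@det1 F m); congr (\det _); apply/matrixP => i j; rewrite !mxE.
Qed.

(* With a column of ones prepended, the label matrix is singular: its rows sum to one. *)
Lemma label_det_cocycle n (l : 'I_n.+1 -> 'I_n) :
  \sum_(j < n.+1) (-1) ^+ j * label_det (fun i => l (lift j i)) = 0.
Proof.
pose c0 : 'I_(1 + n) := lshift n (ord0 : 'I_1).
pose A : 'M[F]_(1 + n) := row_mx (const_mx 1 : 'M_(1 + n, 1)) (label_mx l).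
have : \det A = 0.
  apply/eqP; rewrite -det_tr; apply/det0P.
  exists (row_mx (const_mx 1 : 'M_(1, 1)) (const_mx (-1) : 'M_(1, n))).
    by apply/eqP => /rowP /(_ c0); rewrite row_mxEl !mxE => /eqP; rewrite oner_eq0.
  rewrite tr_row_mx mul_row_col; apply/rowP => j; rewrite !mxE big_ord1 !mxE mul1r.
  rewrite (bigD1 (l j))//= !mxE eqxx mulr1 big1 ?addr0 ?subrr// => k /negbTE kl.
  by rewrite !mxE eq_sym kl mulr0.
move=> detA; rewrite -[RHS]detA (expand_det_col A c0); apply: eq_bigr => j _.
rewrite row_mxEl !mxE mul1r /cofactor addn0; congr (_ * \det _).
apply/matrixP => a b; rewrite mxE [RHS]mxE [RHS]mxE.
have -> : lift c0 b = rshift 1 b by apply: val_inj.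
by rewrite row_mxEr mxE.
Qed.

Variable V : Type.

Lemma label_cocycle n (L : V -> 'I_n.+1) :
  cocycle n (fun v => label_det (fun i : 'I_n.+1 => L (v i))).
Proof.
split=> [v v' E|v].
  congr (\det _); apply/matrixP => i j; rewrite !mxE E//.
  by rewrite -ltnS ltn_ord.
exact: (label_det_cocycle (fun i => L (v i))).
Qed.

Lemma step_cocycle (f : V -> F) : cocycle 1 (fun v => f (v 1%N) - f (v 0%N)).
Proof.
split=> [v v' E|v]; first by rewrite !E.
rewrite /cobound !big_ord_recl big_ord0 /delseq /bump/= expr0 expr1 -signr_odd/= expr0 !mul1r.
by rewrite add0n addn0; ring.
Qed.

End LabelDeterminant.

Section AdjacentSwaps.
Variable n : nat.

Definition adj_swap (i : nat) : 'S_n.+1 := tperm (inord i) (inord i.+1).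

Lemma adj_swap_card_eq (T : Type) (W : {set 'I_n.+1} -> T) :
  (forall (B : {set 'I_n.+1}) (i : nat), (i < n)%N -> inord i \notin B -> inord i.+1 \in B ->
    W (adj_swap i @: B) = W B) ->
  forall B C : {set 'I_n.+1}, #|B| = #|C| -> W B = W C.
Proof.
move=> HW; pose init m := [set i : 'I_n.+1 | (i < m)%N].
have card_init m : (m <= n.+1)%N -> #|init m| = m.
  move=> mn; rewrite -sum1_card (eq_bigl (fun i : 'I_n.+1 => (i < m)%N)) => [|i].
    by rewrite -(big_ord_widen _ (fun=> 1%N) mn) sum1_card card_ord.
  by rewrite inE.
suff key (B : {set 'I_n.+1}) : W B = W (init #|B|) by move=> B C BC; rewrite key BC -key.
(* Swapping down a step of [B] decreases the sum of its elements until [B] is an initial segment. *)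
have [m] := ubnP (\sum_(i in B) i); elim: m B => // m IH B Bm.
have [/existsP[i /andP[iB i1B]]|/existsPn nB] :=
  boolP [exists i : 'I_n, (inord i \notin B) && (inord i.+1 \in B)].
  have sB : #|adj_swap i @: B| = #|B| by apply/card_imset/perm_inj.
  rewrite -(HW _ _ (ltn_ord i) iB i1B) -sB; apply: IH.
  rewrite big_imset/=; last by move=> ? ? _ _; apply: perm_inj.
  rewrite -ltnS; apply: leq_trans Bm; rewrite ltnS.
  rewrite (bigD1 (inord i.+1))//= [X in (_ < X)%N](bigD1 (inord i.+1))//=.
  rewrite /adj_swap tpermR.
  have -> : nat_of_ord (inord i.+1 : 'I_n.+1) = i.+1 by rewrite inordK// ltnS.
  have -> : nat_of_ord (inord i : 'I_n.+1) = i by rewrite inordK// ltnS ltnW.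
  rewrite -addSn leq_add2l; apply: leq_sum => j /andP[jB jS].
  by rewrite tpermD// eq_sym//; apply: contraNneq iB => <-.
have [/eqP ->|nT] := boolP (B == setT).
  by rewrite cardsT card_ord; congr W; apply/setP => i; rewrite !inE ltn_ord.
have [i0 i0B] : exists i, i \notin B.
  apply/existsP; apply: contraR nT => /existsPn h; apply/eqP/setP => i.
  by rewrite inE; apply/negPn/h.
case: (@arg_minnP _ i0 (fun i => i \notin B) (fun i : 'I_n.+1 => nat_of_ord i) i0B) => a aB amin.
suff -> : B = init a by rewrite card_init// ltnW.
apply/setP => i; rewrite inE; apply/idP/idP => [iB|]; last first.
  by apply: contraTT => /amin; rewrite -leqNgt.
rewrite ltnNge; apply/negP => ai; have {iB} : i \in B := iB.
have nin : forall c, (a <= c <= n)%N -> inord c \notin B.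
  elim=> [|c IHc] /andP[ac cn].
    by have -> : inord 0 = a by apply: val_inj; rewrite /= inordK//; apply/eqP; rewrite eq_sym -leqn0.
  move: ac; rewrite leq_eqVlt => /orP[/eqP <-|ac]; first by rewrite inord_val.
  have := nB (Ordinal cn); rewrite negb_and negbK/= => /orP[|//].
  by rewrite (negbTE (IHc _))// -ltnS ac ltnW.
by rewrite -(inord_val i) (negbTE (nin i _))// ai -ltnS ltn_ord.
Qed.

(** Group the sum by the set [A s]. Swaps make the partial sums depend only on the cardinality [k]
    of this set, so for [0 < k < n.+1] the sets of size [k] contribute a multiple of ['C(n.+1, k)],
    which is zero in [F]; the two extreme sets contribute zero by assumption. *)
Lemma pchar_adj_swap_sum0 (F : fieldType) (pF : n.+1 \in [pchar F])
    (S : finType) (P : pred S) (w : S -> F) (A : S -> {set 'I_n.+1}) (act : nat -> S -> S) :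
  (forall i, (i < n)%N -> involutive (act i)) ->
  (forall i s, (i < n)%N -> P (act i s) = P s) ->
  (forall i s, (i < n)%N -> A (act i s) = adj_swap i @: A s) ->
  (forall i s, (i < n)%N -> (inord i \in A s) != (inord i.+1 \in A s) -> P s ->
    w (act i s) = w s) ->
  (forall s, P s -> A s = set0 \/ A s = setT -> w s = 0) ->
  \sum_(s | P s) w s = 0.
Proof.
move=> actK Pact Aact wact w0.
pose W B := \sum_(s | P s && (A s == B)) w s.
have Wcard : forall B C : {set 'I_n.+1}, #|B| = #|C| -> W B = W C.
  apply: adj_swap_card_eq => B i lin iB i1B.
  rewrite /W (reindex_inj (inv_inj (actK i lin))).
  rewrite (eq_bigl (fun s => P s && (A s == B))) => [|s]; last first.
    by rewrite Pact// Aact// (inj_eq (imset_inj (@perm_inj _ _))).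
  apply: eq_bigr => s /andP[Ps /eqP AB]; apply: wact => //.
  by rewrite AB (negbTE iB) i1B.
rewrite (partition_big A xpredT)//=.
have np : prime n.+1 by have /andP[] := pF.
rewrite (partition_big (fun B : {set 'I_n.+1} => inord #|B| : 'I_n.+2) xpredT)//=.
apply: big1 => k _.
pose B0 := [set i : 'I_n.+1 | (i < k)%N].
have card_k (B : {set 'I_n.+1}) : ((inord #|B| : 'I_n.+2) == k) = (#|B| == k).
  by rewrite -val_eqE/= inordK// ltnS -[X in (_ <= X)%N]card_ord max_card.
have [kp|] := boolP (0 < k < n.+1)%N; last first.
  move=> nk; apply: big1 => B; rewrite card_k => /eqP Bk; apply: big1 => s /andP[Ps /eqP AB].
  apply: w0 => //; rewrite AB; have [k0|k0] := posnP k.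
    by left; apply: cards0_eq; rewrite Bk k0.
  move: nk; rewrite k0/= -leqNgt -Bk => ge; right; apply/eqP.
  by rewrite eqEcard subsetT cardsT card_ord.
have [/existsP[B1 /eqP B1k]|/existsPn none] :=
  boolP [exists B : {set 'I_n.+1}, #|B| == k]; last first.
  by apply: big1 => B; rewrite card_k (negbTE (none B)).
rewrite (eq_bigr (fun=> W B1)) => [|B]; last by rewrite card_k => /eqP Bk; apply: Wcard; rewrite Bk.
rewrite (eq_bigl _ _ card_k) sumr_const -mulr_natr.
have -> : #|[pred B : {set 'I_n.+1} | #|B| == k]| = 'C(n.+1, k).
  by rewrite -[X in 'C(X, _)]card_ord -card_draws; apply: eq_card => B; rewrite !inE.
suff -> : 'C(n.+1, k)%:R = 0 :> F by rewrite mulr0.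
by apply/eqP; rewrite -(dvdn_pcharf pF) prime_dvd_bin.
Qed.

Lemma gap_exists (f : 'I_n.+1 -> nat) D i0 i1 : (f i0 + n.+1 * D <= f i1)%N ->
  exists m, [/\ forall i, (f i <= m)%N || (m + D <= f i)%N,
    exists i, (f i <= m)%N & exists i, (m + D <= f i)%N].
Proof.
move=> spread; have [/existsP[j /forallP gap]|] :=
  boolP [exists j : 'I_n.+1, [forall i, (f i <= f i0 + j * D)%N || (f i0 + j * D + D <= f i)%N]].
  exists (f i0 + j * D)%N; split => //; first by exists i0; rewrite leq_addr.
  exists i1; rewrite (leq_trans _ spread)// -addnA leq_add2l addnC -mulSn.
  by rewrite leq_mul2r ltn_ord orbT.
move=> /existsPn h.
(* Otherwise each of the [n.+1] strips contains some [f i], so one index in a strip is [i0]. *)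
have hit (j : 'I_n.+1) : exists i, (f i0 + j * D < f i < f i0 + j * D + D)%N.
  have /forallPn[i] := h j; rewrite negb_or -!ltnNge => ?; by exists i.
have [c cP] := fin_all_exists hit.
have cinj : injective c.
  move=> j k cjk; apply: val_inj => /=; have := cP j; have := cP k; rewrite cjk.
  have wlogc (a b : nat) x : (a < b)%N -> (f i0 + b * D < x)%N -> (x < f i0 + a * D + D)%N -> False.
    move=> ab lo hi; have := ltn_trans lo hi; rewrite -addnA ltn_add2l addnC -mulSn ltn_mul2r.
    by move=> /andP[_]; rewrite ltnS leqNgt ab.
  move=> /andP[lo hi] /andP[lo' hi'].
  by case: (ltngtP j k) => // /wlogc; [move=> /(_ _ lo hi')|move=> /(_ _ lo' hi)].
have [g _ gK] := injF_bij cinj.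
by have /andP[+ _] := cP (g i0); rewrite gK ltnNge leq_addr.
Qed.

End AdjacentSwaps.

(** * The prism over a block grid *)

Section Blocks.
Variables (n r : nat).
Local Notation p := n.+1.
Local Notation q := (r * p)%N.
Local Notation vertex := ('I_q.+1 -> nat).

(* Coordinate [0] is the direction of the prism; [idx k i] is the [i]-th coordinate of block [k]. *)
Definition idx (k i : nat) : 'I_q.+1 := inord (k * p + i).+1.

Lemma idx_val k i : (k < r)%N -> (i < p)%N -> idx k i = (k * p + i).+1 :> nat.
Proof.
move=> kr ip; rewrite inordK// !ltnS; apply: leq_trans (_ : k.+1 * p <= _)%N.
  by rewrite mulSn addnC ltn_add2r.
by rewrite leq_mul2r kr orbT.
Qed.

Lemma idx_inj k i k' i' : (k < r)%N -> (i < p)%N -> (k' < r)%N -> (i' < p)%N ->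
  idx k i = idx k' i' -> k = k' /\ i = i'.
Proof.
move=> kr ip kr' ip' /(congr1 val); rewrite /= !idx_val// => -[E].
have := congr1 (divn^~ p) E; rewrite /= !divnMDl// !divn_small// !addn0 => kk.
by split=> //; move: E; rewrite kk => /addnI.
Qed.

Lemma idx_neq0 k i : (k < r)%N -> (i < p)%N -> idx k i != ord0.
Proof. by move=> kr ip; rewrite -val_eqE/= idx_val. Qed.

Lemma idxP (c : 'I_q.+1) : c != ord0 -> exists (k : 'I_r) (i : 'I_p), c = idx k i.
Proof.
case: c => -[//|c] /= lt _; have cq : (c < r * p)%N by rewrite -ltnS.
have kr : (c %/ p < r)%N by rewrite ltn_divLR.
exists (Ordinal kr), (Ordinal (ltn_pmod c (ltn0Sn n))); apply: val_inj.
by rewrite /= idx_val//= ?ltn_pmod// -divn_eq.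
Qed.

(** For [m = r] this exchanges the columns [i] and [i.+1] in all blocks at once; a general [m]
    serves the inductions. *)
Definition block_swap (m i : nat) : 'S_q.+1 := \prod_(k < m) tperm (idx k i) (idx k i.+1).

Lemma block_swap0 m i : (m <= r)%N -> (i < n)%N -> block_swap m i ord0 = ord0.
Proof.
move=> + lin; rewrite /block_swap; elim: m => [|m IH] mr; first by rewrite big_ord0 perm1.
rewrite big_ord_recr/= permM IH ?(ltnW mr)// tpermD//; apply: idx_neq0 => //.
by rewrite ltnW// ltnS.
Qed.

Lemma block_swap_idx m i k (j : 'I_p) : (m <= r)%N -> (i < n)%N -> (k < r)%N ->
  block_swap m i (idx k j) = idx k (if (k < m)%N then adj_swap n i j else j).
Proof.
move=> + lin kr; rewrite /block_swap; elim: m => [|m IH] mr; first by rewrite big_ord0 perm1.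
rewrite big_ord_recr/= permM IH ?(ltnW mr)//.
have ip : (i < p)%N by rewrite ltnS ltnW.
have iv : nat_of_ord (inord i : 'I_p) = i by rewrite inordK// ltnW.
have iv1 : nat_of_ord (inord i.+1 : 'I_p) = i.+1 by rewrite inordK.
have [->|km] := eqVneq k m; rewrite ?ltnn ?ltnSn.
  rewrite /adj_swap; case: (tpermP (inord i) (inord i.+1) j) => [->|->|/eqP ji /eqP ji1]; first by rewrite iv iv1 tpermL.
    by rewrite iv iv1 tpermR.
  rewrite tpermD//; apply/eqP => /idx_inj[]// _ /esym E.
    by case/eqP: ji; apply: val_inj; rewrite /= iv.
  by case/eqP: ji1; apply: val_inj; rewrite /= iv1.
rewrite [(k < m.+1)%N]ltnS [(k <= m)%N]leq_eqVlt (negbTE km).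
by rewrite tpermD//; apply/eqP => /idx_inj[]// E; case/eqP: km.
Qed.

Lemma block_swap_odd m i : (m <= r)%N -> (i < n)%N -> odd_perm (block_swap m i) = odd m.
Proof.
move=> + lin; rewrite /block_swap; elim: m => [|m IH] mr; first by rewrite big_ord0 odd_perm1.
rewrite big_ord_recr/= odd_permM IH ?(ltnW mr)// odd_tperm.
suff -> : idx m i != idx m i.+1 by rewrite addbT.
apply/eqP => /idx_inj[]//; first by rewrite ltnW.
by move=> _ /eqP; rewrite eqn_leq ltnn andbF.
Qed.

Lemma adj_swapK i : involutive (adj_swap n i).
Proof. exact: tpermK. Qed.

Lemma block_swapK i : (i < n)%N -> involutive (block_swap r i).
Proof.
move=> lin c; have [->|/idxP[k [j ->]]] := eqVneq c ord0; first by rewrite !block_swap0.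
by rewrite !block_swap_idx// ltn_ord adj_swapK.
Qed.

Definition block_sum k (u : vertex) := (\sum_(i < p) u (idx k i))%N.

Lemma block_sum_swap i k u : (i < n)%N -> (k < r)%N ->
  block_sum k (u \o block_swap r i) = block_sum k u.
Proof.
move=> lin kr; rewrite /block_sum [RHS](reindex_inj (@perm_inj _ (adj_swap n i))).
by apply: eq_bigr => j _; rewrite /= block_swap_idx// kr.
Qed.

Variables (G H : nat).

Definition far i (u : vertex) := exists2 k, (k < r)%N &
  (u (idx k i) + G <= u (idx k i.+1))%N || (u (idx k i.+1) + G <= u (idx k i))%N.

(** The restriction to [far] is essential: on equal columns the swap fixes [u], so full equivariance
    would forbid the labels [i] and [i.+1] there. *)
Definition swap_equivariant (L : nat -> vertex -> 'I_p) := forall k i u,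
  (k < r)%N -> (i < n)%N -> far i u -> L k (u \o block_swap r i) = adj_swap n i (L k u).

Variable F : fieldType.

Definition crossing k (u : vertex) : F := (H <= block_sum k u)%:R.

(** Detects runs of [p.+1] vertices whose first [p] vertices carry all labels and whose last edge
    crosses the threshold [H] of the block sum. *)
Definition block_cochain (L : nat -> vertex -> 'I_p) k (v : nat -> vertex) : F :=
  cup n (fun w => label_det F (fun i : 'I_p => L k (w i)))
        (fun w => crossing k (w 1%N) - crossing k (w 0%N)) v.

Definition euler_cochain L (v : nat -> vertex) : F :=
  \prod_(k < r) block_cochain L k (tailseq (k * p) v).

Lemma euler_cocycle L : cocycle q (euler_cochain L).
Proof.
apply: cocycle_prod_windows => k.
have := cup_cocycle (label_cocycle F (L k)) (step_cocycle (crossing k)).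
by rewrite addn1.
Qed.

Lemma eq_euler_cochain L L' v :
  (forall k (i : 'I_p), (k < r)%N -> L k (v (k * p + i)%N) = L' k (v (k * p + i)%N)) ->
  euler_cochain L v = euler_cochain L' v.
Proof.
move=> E; apply: eq_bigr => k _; rewrite /block_cochain /cup; congr (_ * _).
by congr (\det _); apply/matrixP => i j; rewrite !mxE /tailseq E.
Qed.

(** Each of the [r] determinants changes by the sign of an adjacent transposition, while block sums
    are symmetric. In [wall_sum0] the factor cancels against the sign of [block_swap]. *)
Lemma euler_cochain_swap L i v : swap_equivariant L -> (i < n)%N ->
  (forall j, far i (v j)) ->
  euler_cochain L (fun j => v j \o block_swap r i) = (-1) ^+ r * euler_cochain L v.
Proof.
move=> Leq lin vfar; rewrite /euler_cochain.
have -> : (-1) ^+ r = \prod_(k < r) (-1) :> F by rewrite prodr_const card_ord.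
rewrite -big_split/=; apply: eq_bigr => k _.
rewrite /block_cochain /cup /tailseq /crossing !block_sum_swap// mulrA; congr (_ * _).
have -> : -1 = (-1) ^+ adj_swap n i :> F.
  rewrite /adj_swap odd_tperm -val_eqE/= !inordK ?ltnS//; last exact: ltnW.
  by rewrite neq_ltn ltnSn.
by rewrite -label_det_perm; congr (\det _); apply/matrixP => a b; rewrite !mxE Leq.
Qed.

(** Block sums increase along a simplex, so a nonzero step can only be an upward crossing of [H].
    The offset [b] selects which of the two end vertices of the simplex is left out. *)
Lemma euler_cochain_neq0 B (s : {ffun 'I_q.+1 -> 'I_B.+1} * 'S_q.+1) b L :
  let v j := kuhn_vertex s (b + j) in
  euler_cochain L v != 0 -> forall k, (k < r)%N ->
  [/\ injective (fun i : 'I_p => L k (v (k * p + i)%N)),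
      (block_sum k (v (k * p + n)) < H)%N &
      (H <= block_sum k (v (k * p + p)))%N].
Proof.
move=> v /prodf_neq0 nz k kr; have := nz (Ordinal kr) isT.
rewrite /block_cochain /cup mulf_eq0 negb_or => /andP[/label_det_inj inj].
rewrite /crossing /tailseq/= addn0 addn1 subr_eq0 => ne; split=> //.
  rewrite ltnNge; apply: contra ne => le1.
  have le2 : (H <= block_sum k (v (k * p + p)))%N.
    apply: leq_trans le1 _; apply: leq_sum => i _; rewrite /v /kuhn_vertex leq_add2l.
    by case: ltnP => // /leq_trans ->//; rewrite leq_add2l leq_add2l.
  by rewrite le1 le2.
rewrite leqNgt; apply: contra ne => lt.
have le1 : (block_sum k (v (k * p + n)) < H)%N.
  apply: leq_ltn_trans lt; apply: leq_sum => i _; rewrite /v /kuhn_vertex leq_add2l.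
  by case: ltnP => // /leq_trans ->//; rewrite leq_add2l leq_add2l.
by rewrite leqNgt lt leqNgt le1.
Qed.

Variable M0 : nat.
(** The box has side about [2 * M0], and [H] is the block sum when all [p] coordinates equal
    [M0.+1], close to the centre. A spread of [M0] among [p] numbers forces a gap of [G.+1]. *)
Hypotheses (pF : p \in [pchar F]) (M0E : M0 = (p * G.+1)%N) (HE : H = (p * M0.+1)%N).

Notation simplex := ({ffun 'I_q.+1 -> 'I_(M0.*2).+1} * 'S_q.+1)%type.
Implicit Type s : simplex.

Definition extent (c : 'I_q.+1) : nat := if c == ord0 then 1 else (M0.*2).+1.

Lemma extent_le c : (extent c <= (M0.*2).+1)%N.
Proof. by rewrite /extent; case: ifP. Qed.

(** The gap is [G.+1] at the start of the simplex, so that [G] is left at each of its vertices,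
    where coordinates have grown by at most one. *)
Definition is_gap (u : {ffun 'I_q.+1 -> 'I_(M0.*2).+1}) (km : 'I_r * 'I_(M0.*2).+1) :=
  [&& [forall i : 'I_p, (u (idx km.1 i) <= km.2)%N || (km.2 + G.+1 <= u (idx km.1 i))%N],
   [exists i : 'I_p, (u (idx km.1 i) <= km.2)%N] &
   [exists i : 'I_p, (km.2 + G.+1 <= u (idx km.1 i))%N]].

(* Any choice of the gap will do, as long as it is invariant under swaps. *)
Definition lower_part (u : {ffun 'I_q.+1 -> 'I_(M0.*2).+1}) : {set 'I_p} :=
  if [pick km | is_gap u km] is Some km then [set i : 'I_p | (u (idx km.1 i) <= km.2)%N]
  else set0.

Definition swap_simplex i s : simplex :=
  ([ffun c => s.1 (block_swap r i c)], (block_swap r i * s.2)%g).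

Lemma swap_simplexK i : (i < n)%N -> involutive (swap_simplex i).
Proof.
move=> lin [u s]; rewrite /swap_simplex/=; congr pair.
  by apply/ffunP => c; rewrite !ffunE block_swapK.
by rewrite mulgA; apply/permP => c; rewrite !permM block_swapK.
Qed.

Lemma kuhn_vertex_swap i s j :
  kuhn_vertex (swap_simplex i s) j = kuhn_vertex s j \o block_swap r i.
Proof. by apply/funext => c; rewrite /kuhn_vertex/= ffunE permM. Qed.

Lemma is_gap_swap i (u : {ffun 'I_q.+1 -> 'I_(M0.*2).+1}) km : (i < n)%N ->
  is_gap [ffun c => u (block_swap r i c)] km = is_gap u km.
Proof.
move=> lin; rewrite /is_gap; have sw (j : 'I_p) : block_swap r i (idx km.1 j) = idx km.1 (adj_swap n i j).
  by rewrite block_swap_idx// ltn_ord.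
congr [&& _, _ & _].
- apply/forallP/forallP => h j; have := h (adj_swap n i j);
    by rewrite ?ffunE ?sw ?adj_swapK.
- apply/existsP/existsP => -[j h]; exists (adj_swap n i j); move: h;
    by rewrite ?ffunE ?sw ?adj_swapK.
- apply/existsP/existsP => -[j h]; exists (adj_swap n i j); move: h;
    by rewrite ?ffunE ?sw ?adj_swapK.
Qed.

Lemma lower_part_swap i s : (i < n)%N ->
  lower_part (swap_simplex i s).1 = adj_swap n i @: lower_part s.1.
Proof.
move=> lin; rewrite /lower_part (eq_pick (fun km => is_gap_swap s.1 km lin)).
case: pickP => [km _|_]; last by rewrite imset0.
apply/setP => j; rewrite inE ffunE block_swap_idx// ltn_ord.
rewrite -{2}[j](adj_swapK i) mem_imset ?inE//; exact: perm_inj.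
Qed.

Lemma lower_part_far b i s j : (i < n)%N ->
  (inord i \in lower_part s.1) != (inord i.+1 \in lower_part s.1) ->
  far i (kuhn_vertex s (b + j)).
Proof.
move=> lin; rewrite /lower_part; case: pickP => [km /and3P[/forallP gap _ _]|_]; last by rewrite !inE.
rewrite !inE => ne; exists km.1 => //; move: ne (gap (inord i)) (gap (inord i.+1)).
rewrite !inordK ?ltnS//; last exact: ltnW.
rewrite /kuhn_vertex.
set x := nat_of_ord (s.1 _); set y := nat_of_ord (s.1 (idx _ i.+1)).
set a := nat_of_bool _; set c := nat_of_bool _.
have : (a <= 1)%N /\ (c <= 1)%N by rewrite /a /c; do 2 case: (_ < _)%N.
by move: (nat_of_ord km.2) => m [a1 c1]; case: (leqP x m); case: (leqP y m) => //= *; apply/orP; lia.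
Qed.

Definition on_wall s := exists2 c, c != ord0 & (s.1 c = 0 :> nat) \/ (s.1 c = M0.*2 :> nat).

(** A nonzero cochain keeps every block sum near [H], so a coordinate at one end of the box forces
    another one of its block to be at distance at least [M0]; then [gap_exists] applies. *)
Lemma wall_gap b s L : (b <= 1)%N -> on_wall s ->
  euler_cochain L (fun j => kuhn_vertex s (b + j)) != 0 ->
  lower_part s.1 != set0 /\ lower_part s.1 != setT.
Proof.
move=> b1 [c /idxP[k [i ->]] pin] /euler_cochain_neq0 nz.
have [_ lo hi] := nz k (ltn_ord k).
suff [km gap] : exists km, is_gap s.1 km.
  rewrite /lower_part; case: pickP => [{}km {gap} /and3P[_ /existsP[j jlo] /existsP[j' jhi]]|]; last first.
    by move/(_ km); rewrite gap.
  split; first by apply/set0Pn; exists j; rewrite inE.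
  apply/eqP => /setP /(_ j'); rewrite !inE => le.
  by move: jhi; rewrite leqNgt (leq_ltn_trans le)// addnS ltnS leq_addr.
have [i0 [i1 spread]] : exists i0 i1 : 'I_p, (s.1 (idx k i0) + p * G.+1 <= s.1 (idx k i1))%N.
  rewrite -M0E; case: pin => [pin0|pinM].
    exists i; rewrite pin0 add0n; apply/existsP; move: hi; apply: contraLR => /existsPn h.
    rewrite -ltnNge HE; apply: leq_ltn_trans (_ : \sum_(j < p) M0 < _)%N.
      apply: leq_sum => j _; have := h j; rewrite -ltnNge; apply: leq_trans.
      by rewrite /kuhn_vertex -[X in (_ <= X)%N]addn1 leq_add2l leq_b1.
    by rewrite sum_nat_const card_ord ltn_mul2l/=.
  suff [j hj] : exists j : 'I_p, (s.1 (idx k j) <= M0)%N.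
    by exists j, i; rewrite pinM -[X in (_ <= X)%N]addnn leq_add2r.
  apply/existsP; move: lo; apply: contraLR => /existsPn h.
  rewrite -leqNgt HE; apply: leq_trans (_ : \sum_(j < p) M0.+1 <= _)%N.
    by rewrite sum_nat_const card_ord.
  by apply: leq_sum => j _; have := h j; rewrite -ltnNge => /leq_trans; apply; rewrite leq_addr.
have [m [gap lom him]] := @gap_exists n (fun j => s.1 (idx k j)) _ _ _ spread.
have mlt : (m < (M0.*2).+1)%N.
  have [j hj] := him; apply: leq_ltn_trans (ltn_ord (s.1 (idx k j))).
  by rewrite (leq_trans _ hj)// leq_addr.
by exists (k, Ordinal mlt); apply/and3P; split; [exact/forallP|exact/existsP|exact/existsP].
Qed.

(** The vanishing modulo [p] comes from [pchar_adj_swap_sum0] with the subset [lower_part]. Facets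
    without the first vertex have [b = 1], those without the last have [b = 0]. *)
Lemma wall_sum0 b (P : pred simplex) L : (b <= 1)%N -> swap_equivariant L ->
  (forall s, P s -> on_wall s) ->
  (forall i s, (i < n)%N -> P (swap_simplex i s) = P s) ->
  \sum_(s | P s) (-1) ^+ s.2 * euler_cochain L (fun j => kuhn_vertex s (b + j)) = 0.
Proof.
move=> b1 Leq Pwall Pswap.
apply: (@pchar_adj_swap_sum0 n F pF _ P _ (fun s => lower_part s.1) swap_simplex) => //.
- exact: swap_simplexK.
- by move=> i s lin; apply: lower_part_swap.
- move=> i s lin ne _; rewrite /= odd_permM block_swap_odd// signr_addb signr_odd.
  have -> : (fun j => kuhn_vertex (swap_simplex i s) (b + j)) =
            (fun j => kuhn_vertex s (b + j) \o block_swap r i).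
    by apply/funext => j; rewrite kuhn_vertex_swap.
  rewrite euler_cochain_swap// => [|j]; last exact: lower_part_far.
  by rewrite mulrACA -expr2 sqrr_sign mul1r.
- move=> s Ps h; have [->|nz] := eqVneq (euler_cochain L (fun j => kuhn_vertex s (b + j))) 0.
    by rewrite mulr0.
  by have [ne0 neT] := wall_gap b1 (Pwall s Ps) nz; case: h => /eqP; rewrite ?(negbTE ne0) ?(negbTE neT).
Qed.

Lemma swap_equivariant_prism L0 L1 : swap_equivariant L0 -> swap_equivariant L1 ->
  swap_equivariant (fun k u => if u ord0 == 0%N then L0 k u else L1 k u).
Proof.
by move=> eq0 eq1 k i u kr lin uf; rewrite /= block_swap0//; case: ifP; [rewrite eq0|rewrite eq1].
Qed.

(* The prism has labels [L0] at height [0] and [L1] at height [1]. *)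
Lemma euler_cobordism L0 L1 : swap_equivariant L0 -> swap_equivariant L1 ->
  \sum_(s : simplex | in_box extent s && (first_dir s == ord0))
    (-1) ^+ s.2 * euler_cochain L1 (fun j => kuhn_vertex s j.+1) +
  (-1) ^+ q.+1 * \sum_(s : simplex | in_box extent s && (last_dir s == ord0))
    (-1) ^+ s.2 * euler_cochain L0 (kuhn_vertex s) = 0.
Proof.
move=> eq0 eq1; set L := (fun k u => if u ord0 == 0%N then L0 k u else L1 k u) : nat -> vertex -> 'I_p.
have Leq : swap_equivariant L by apply: swap_equivariant_prism.
have [Lr Lc] := euler_cocycle L.
have Lext (v v' : nat -> vertex) : (forall i, (i <= q)%N -> v i =1 v' i) ->
    euler_cochain L v = euler_cochain L v'.
  by move=> vv'; apply: Lr => i iq; apply/funext/vv'.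
have := kuhn_boundary extent_le Lext.
rewrite big1 => [|s _]; last by rewrite Lc mulr0.
(* Boundary facets with direction [ord0] form the top and the bottom of the prism; all others lie on
   walls. *)
rewrite (bigID (fun s => first_dir s == ord0))/= [X in _ + _ * X](bigID (fun s => last_dir s == ord0))/=.
have dir0 s (c : 'I_q.+1) : in_box extent s -> c = ord0 -> s.1 c = 0 :> nat.
  by move=> /forallP /(_ ord0) + ->; rewrite /extent eqxx ltnS leqn0 => /eqP.
have wall_last s c : c != ord0 -> s.1 c = 0 :> nat -> on_wall s by move=> c0 sc; exists c; auto.
have swap_box i s : (i < n)%N -> in_box extent (swap_simplex i s) = in_box extent s.
  have ext c : (i < n)%N -> extent (block_swap r i c) = extent c.
    move=> lin; rewrite /extent -[in LHS](block_swap0 (leqnn r) lin).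
    by rewrite (inj_eq (@perm_inj _ _)).
  move=> lin; apply/forallP/forallP => h c; have := h (block_swap r i c);
    by rewrite ?ffunE ?block_swapK// ?ext.
have swapV i s c : (i < n)%N -> ((swap_simplex i s).2)^-1%g c = block_swap r i ((s.2)^-1%g c).
  move=> lin; apply: (@perm_inj _ (swap_simplex i s).2).
  by rewrite permKV /= permM block_swapK// permKV.
have swap_eq0 i c : (i < n)%N -> (block_swap r i c == ord0) = (c == ord0).
  by move=> lin; rewrite -[in LHS](block_swap0 (leqnn r) lin) (inj_eq (@perm_inj _ _)).
have swap_val i s c : (i < n)%N -> (swap_simplex i s).1 (block_swap r i c) = s.1 c.
  by move=> lin; rewrite ffunE block_swapK.
have swap_ext i c : (i < n)%N -> extent (block_swap r i c) = extent c.
  by move=> lin; rewrite /extent swap_eq0.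
rewrite [X in _ + X + _](wall_sum0 (b := 1) _ Leq)//; first last.
- move=> i s lin; rewrite swap_box// /first_dir swapV// swap_eq0//.
  by rewrite swap_val// swap_ext.
- move=> s /andP[/andP[_ /eqP E] ne]; exists (first_dir s) => //; right.
  by apply/eq_add_S; rewrite E /extent (negbTE ne).
rewrite [X in _ * (_ + X)](wall_sum0 (b := 0) _ Leq)//; first last.
- by move=> i s lin; rewrite swap_box// /last_dir swapV// swap_eq0// swap_val.
- by move=> s /andP[/andP[_ /eqP E] ne]; exists (last_dir s) => //; left.
rewrite !addr0 => E; rewrite [RHS]E {E}; congr (_ + _ * _).
  apply: eq_big => [s|s /andP[bs /eqP s0]].
    case: (boolP (in_box extent s)) => //= bs; case: eqP => s0; rewrite ?andbF// andbT.
    by rewrite (dir0 _ _ bs s0) s0 /extent eqxx.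
  congr (_ * _); apply: eq_euler_cochain => k i kr.
  rewrite /L /kuhn_vertex; have -> : s.2 ord0 = ord0 by rewrite -s0 permKV.
  by rewrite addn1.
apply: eq_big => [s|s /andP[bs /eqP s0]].
  case: (boolP (in_box extent s)) => //= bs; case: eqP => s0; rewrite ?andbF// andbT.
  by rewrite (dir0 _ _ bs s0).
congr (_ * _); apply: eq_euler_cochain => k i kr.
rewrite /L /kuhn_vertex; have -> : s.2 ord0 = ord_max by rewrite -s0 permKV.
rewrite (dir0 _ ord0 bs)// add0n ltnNge.
suff -> : (k * p + i <= q)%N by [].
apply: leq_trans (_ : k.+1 * p <= _)%N; last by rewrite leq_mul2r kr orbT.
by rewrite mulSn addnC leq_add2r ltnW.
Qed.

End Blocks.

(** * The reference labelling *)

Section Selection.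
Variables (n : nat) (d : Order.disp_t) (T : orderType d).
Implicit Types (m : 'I_n.+1 -> T) (code : 'I_n.+1 -> nat).

(* Ties for the largest [m] are broken by the largest [code], then by the largest index: the last
   rule commutes with an adjacent swap provided that [code] separates the two indices. *)
Definition best m code : {set 'I_n.+1} :=
  [set i | [forall j, (m j <= m i)%O] &&
           [forall j, [forall l, (m l <= m j)%O] ==> (code j <= code i)%N]].

Definition sel m code : 'I_n.+1 :=
  odflt ord0 [pick i | (i \in best m code) && [forall j, (j \in best m code) ==> (j <= i)%N]].

Lemma best_neq0 m code : exists i, i \in best m code.
Proof.
have [i0 _ i0max] := @Order.TotalTheory.arg_maxP _ _ _ (ord0 : 'I_n.+1) xpredT m isT.
have i0P : [forall l, (m l <= m i0)%O] by apply/forallP => l; apply: i0max.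
have [i iP imax] := @arg_maxnP _ i0 (fun j => [forall l, (m l <= m j)%O]) code i0P.
by exists i; rewrite inE iP; apply/forallP => j; apply/implyP/imax.
Qed.

Lemma selP m code : sel m code \in best m code /\
  forall j, j \in best m code -> (j <= sel m code)%N.
Proof.
rewrite /sel; case: pickP => [i /andP[ib /forallP imax]|none].
  by split=> // j jb; apply: (implyP (imax j)).
have [i0 i0b] := best_neq0 m code.
have [i ib imax] := @arg_maxnP _ i0 (fun i => i \in best m code) (fun i => nat_of_ord i) i0b.
have := none i; rewrite ib => /negbT/negP[].
by apply/forallP => j; apply/implyP/imax.
Qed.

Lemma sel_max m code i : (m i <= m (sel m code))%O.
Proof. by have [+ _] := selP m code; rewrite inE => /andP[/forallP]. Qed.

Lemma sel_unique m code i : i \in best m code ->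
  (forall j, j \in best m code -> (j <= i)%N) -> sel m code = i.
Proof.
move=> ib imax; have [sb smax] := selP m code.
by apply/val_inj/eqP; rewrite eqn_leq imax ?smax.
Qed.

Lemma best_swap m code (s : 'S_n.+1) : involutive s ->
  best (m \o s) (code \o s) = s @: best m code.
Proof.
move=> sK; apply/setP => i; rewrite -[i in RHS]sK mem_imset; last exact: perm_inj.
rewrite !inE /=; congr (_ && _).
  by apply/forallP/forallP => h j; have := h (s j); rewrite /= ?sK.
apply/forallP/forallP => h j; have /implyP hj := h (s j); apply/implyP => /forallP h'.
  by move: hj; rewrite /= sK; apply; apply/forallP => l.
by apply: hj; apply/forallP => l; have := h' (s l); rewrite /= sK.
Qed.

(** Tied winners have equal [code], so [i] and [i.+1] do not tie with each other, and replacing one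
    by the other preserves its order against all remaining indices. *)
Lemma sel_swap m code i : (i < n)%N -> code (inord i) != code (inord i.+1) ->
  sel (m \o adj_swap n i) (code \o adj_swap n i) = adj_swap n i (sel m code).
Proof.
move=> lin ne; have [sb smax] := selP m code; set s := adj_swap n i.
have iv : nat_of_ord (inord i : 'I_n.+1) = i by rewrite inordK// ltnS ltnW.
have iv1 : nat_of_ord (inord i.+1 : 'I_n.+1) = i.+1 by rewrite inordK.
apply: sel_unique; rewrite best_swap; try exact: tpermK.
  by rewrite mem_imset//; exact: perm_inj.
move=> _ /imsetP[j jb ->]; have := smax j jb.
have codeE : code j = code (sel m code).
  move: jb sb; rewrite !inE => /andP[mj /forallP cj] /andP[ms /forallP cs].
  by apply/eqP; rewrite eqn_leq (implyP (cs _) mj) (implyP (cj _) ms).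
rewrite /s /adj_swap; case: (tpermP _ _ j) codeE => [->|->|/eqP ji /eqP ji1];
  case: (tpermP _ _ (sel m code)) => [->|->|/eqP si /eqP si1] //.
- by move=> E; rewrite E eqxx in ne.
- rewrite iv iv1 => _ le; rewrite ltn_neqAle le andbT.
  by apply: contra si => /eqP E; apply/eqP/val_inj; rewrite /= iv.
- by move=> E; rewrite E eqxx in ne.
- by rewrite iv iv1 => _ /ltnW.
- by rewrite iv iv1 => _ /leqW.
- rewrite iv iv1 leq_eqVlt => _ /orP[/eqP E|//].
  by case/eqP: ji1; apply: val_inj; rewrite /= iv1.
Qed.

End Selection.

Section Reference.
Variables (n r G : nat).
Local Notation p := n.+1.
Local Notation q := (r * p)%N.
Local Notation vertex := ('I_q.+1 -> nat).

(** Only the injectivity of this code and its behaviour under swaps matter, not the order that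
    [pickle] induces. *)
Definition column (u : vertex) (i : 'I_p) : nat := pickle [ffun k : 'I_r => u (idx n r k i)].

Lemma column_swap i u : (i < n)%N ->
  column (u \o block_swap n r r i) = column u \o adj_swap n i.
Proof.
move=> lin; apply/funext => j; rewrite /column /=; congr pickle.
by apply/ffunP => k; rewrite !ffunE /= block_swap_idx// ltn_ord.
Qed.

Lemma column_far i (u : vertex) : (0 < G)%N -> (i < n)%N -> @far n r G i u ->
  column u (inord i) != column u (inord i.+1).
Proof.
move=> G0 lin [k kr h]; apply/eqP => /(pcan_inj pickleK) /ffunP /(_ (Ordinal kr)).
rewrite !ffunE /= !inordK ?ltnS//; last exact: ltnW.
by case/orP: h; lia.
Qed.

Definition spread (u : vertex) :=
  [exists k : 'I_r, [exists i : 'I_p, [exists j : 'I_p,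
    (u (idx n r k i) + G <= u (idx n r k j))%N]]].

(* Breaking ties by columns makes the labelling equivariant; away from the walls, breaking them by
   the index alone leaves a single simplex with a nonzero cochain. *)
Definition ref_label (k : nat) (u : vertex) : 'I_p :=
  sel (fun i : 'I_p => u (idx n r k i)) (fun i => if spread u then column u i else 0%N).

Lemma spread_swap i u : (i < n)%N -> spread (u \o block_swap n r r i) = spread u.
Proof.
move=> lin; apply/existsP/existsP => -[k /existsP[j1 /existsP[j2 h]]]; exists k;
  apply/existsP; exists (adj_swap n i j1); apply/existsP; exists (adj_swap n i j2);
  by move: h; rewrite /= ?block_swap_idx ?ltn_ord ?adj_swapK// ltn_ord.
Qed.

Lemma ref_label_swap : (0 < G)%N -> @swap_equivariant n r G ref_label.
Proof.
move=> G0 k i u kr lin uf; rewrite /ref_label spread_swap//.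
have su : spread u.
  case: uf => k' k'r h; have l1 : (i < p)%N by rewrite ltnS ltnW.
  have l2 : (i.+1 < p)%N by [].
  apply/existsP; exists (Ordinal k'r); apply/existsP; case/orP: h => h.
    by exists (Ordinal l1); apply/existsP; exists (Ordinal l2).
  by exists (Ordinal l2); apply/existsP; exists (Ordinal l1).
rewrite su column_swap//.
rewrite -[RHS]sel_swap//; last exact: column_far.
by congr sel; apply/funext => j; rewrite /= block_swap_idx// kr.
Qed.

End Reference.

(* Here [x j] is one block at the [j]-th vertex of a run of [n.+2] consecutive vertices: every step
   must increment the coordinate that is maximal next, so the maximisers rotate cyclically. *)
Lemma rotation_unique n M b (z rho : 'I_n.+1 -> nat) (lam : 'I_n.+1 -> 'I_n.+1) :
  (0 < n)%N -> injective lam -> injective rho ->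
  let x j i := (z i + (rho i <= b + j))%N in
  (forall j i : 'I_n.+1, x j i * n.+1 + i <= x j (lam j) * n.+1 + lam j)%N ->
  (\sum_i x n i < n.+1 * M.+1)%N -> (n.+1 * M.+1 <= \sum_i x n.+1 i)%N ->
  forall i, z i = M /\ rho i = (b + i).+1.
Proof.
move=> n0 lamI rhoI x xmax sum_lt sum_ge.
have key_eq a c (i j : 'I_n.+1) : (a * n.+1 + i = c * n.+1 + j)%N -> a = c /\ i = j.
  move=> E; have := congr1 (divn^~ n.+1) E; rewrite /= !divnMDl// !divn_small// !addn0 => ac.
  by split=> //; apply: val_inj; move: E; rewrite ac => /addnI.
have lam_lt (j : nat) : (j <= n)%N -> nat_of_ord (inord j : 'I_n.+1) = j by move=> ?; rewrite inordK.
pose l (j : nat) := lam (inord j).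
have l_inj j j' : (j <= n)%N -> (j' <= n)%N -> l j = l j' -> j = j'.
  by move=> jn j'n /lamI /(congr1 val); rewrite /= !lam_lt.
have l_max j i : (j <= n)%N -> (x j i * n.+1 + i <= x j (l j) * n.+1 + l j)%N.
  by move=> jn; have := xmax (inord j) i; rewrite lam_lt.
have xS j i : (x j i <= x j.+1 i)%N.
  rewrite /x leq_add2l; case: (leqP (rho i) (b + j)) => // le.
  by rewrite (leq_trans le)// leq_add2l.
have rho_l j : (j < n)%N -> rho (l j.+1) = (b + j).+1.
  move=> jn; have h1 := l_max j (l j.+1) (ltnW jn); have h2 := l_max j.+1 (l j) jn.
  have ne : (x j (l j.+1) * n.+1 + l j.+1 <> x j (l j) * n.+1 + l j)%N.
    by move=> /key_eq[_ /l_inj]; rewrite jn ltnW// => /(_ isT isT) /eqP; rewrite eqn_leq ltnn.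
  have {h1}h1 : (x j (l j.+1) * n.+1 + l j.+1 < x j (l j) * n.+1 + l j)%N.
    by rewrite ltn_neqAle h1 andbT; apply/eqP.
  have h3 : (x j (l j) * n.+1 <= x j.+1 (l j) * n.+1)%N by rewrite leq_mul2r xS orbT.
  have : (x j (l j.+1) < x j.+1 (l j.+1))%N.
    by rewrite -(ltn_pmul2r (ltn0Sn n)); lia.
  rewrite /x ltn_add2l; case: (leqP _ (b + j)) => // lo; case: (leqP _ (b + j.+1)) => // hi _.
  by apply/eqP; rewrite eqn_leq lo -addnS hi.
have l_surj i : exists2 j, (j <= n)%N & i = l j.
  have [g _ gK] := injF_bij lamI; exists (g i); first by rewrite -ltnS.
  by rewrite /l inord_val gK.
(* The last step has to raise the sum past the threshold, and the first maximiser is the only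
   coordinate not yet incremented in this run. *)
have rho0 : rho (l 0) = (b + n).+1.
  have [i hi] : exists i, (x n i < x n.+1 i)%N.
    apply/existsP; have := leq_trans sum_lt sum_ge; apply: contraLR => /existsPn h.
    by rewrite -leqNgt; apply: leq_sum => i _; rewrite leqNgt.
  have rhoi : rho i = (b + n).+1.
    move: hi; rewrite /x ltn_add2l; case: (leqP _ (b + n)) => // lo; case: (leqP _ (b + n.+1)) => // hi _.
    by apply/eqP; rewrite eqn_leq lo -addnS hi.
  have [[|j] jn E] := l_surj i; first by rewrite -E.
  by move: rhoi; rewrite E rho_l// => -[] /addnI jE; move: jn; rewrite jE ltnn.
(* Initial keys of the successive maximisers, pairwise distinct modulo [n.+1]. The inequalities
   force [k 1 < .. < k n < k 0 < k 1 + n.+1], so these keys are consecutive numbers. *)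
pose k j := (z (l j) * n.+1 + l j)%N.
have k_neq j j' d : (j <= n)%N -> (j' <= n)%N -> j != j' -> k j <> (k j' + d * n.+1)%N.
  move=> jn j'n ne; rewrite /k addnAC -mulnDl => /key_eq[_ /l_inj].
  by move=> /(_ jn j'n) E; rewrite E eqxx in ne.
have x_l j j' : (j <= n)%N -> (0 < j')%N -> (j' <= n)%N -> x j (l j') = (z (l j') + (j' <= j))%N.
  by move=> jn; case: j' => // j' _ j'n; rewrite /x rho_l// -addnS leq_add2l.
have x_l0 j : (j <= n)%N -> x j (l 0) = z (l 0).
  by move=> jn; rewrite /x rho0 -addnS leq_add2l ltnNge jn addn0.
have k0 j : (0 < j <= n)%N -> (k j < k 0)%N.
  move=> /andP[j0 jn]; have := l_max 0 (l j) isT; rewrite x_l// x_l0// leqn0 eqn0Ngt j0 addn0.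
  rewrite -/(k j) -/(k 0) leq_eqVlt => /orP[/eqP E|//].
  by have := @k_neq j 0 0 jn isT; rewrite mul0n addn0 -lt0n j0 => /(_ isT).
have kS j : (0 < j < n)%N -> (k j < k j.+1)%N.
  move=> /andP[j0 jn]; have := l_max j.+1 (l j) jn; rewrite !x_l ?leqnSn ?leqnn// ?(ltnW jn)//.
  rewrite !mulnDl => h; have : k j <> (k j.+1 + 0 * n.+1)%N.
    by apply: k_neq; rewrite ?(ltnW jn) ?neq_ltn ?ltnSn.
  by rewrite /k; lia.
have k1 : (k 0 < k 1 + n.+1)%N.
  have := l_max 1 (l 0) n0; rewrite x_l0// x_l// leqnn mulnDl mul1n => h.
  have : k 0 <> (k 1 + 1 * n.+1)%N by apply: k_neq.
  by rewrite mul1n => /eqP ne; rewrite ltn_neqAle ne /k addnAC.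
have k_ge j : (0 < j <= n)%N -> (k 1 + j.-1 <= k j)%N.
  case: j => // j /=; elim: j => [|j IH] jn; first by rewrite addn0.
  by rewrite addnS (leq_ltn_trans (IH (ltnW jn)))// kS.
have k_le j : (0 < j <= n)%N -> (k j + (n - j) < k 0)%N.
  move=> /andP[j0 jn]; rewrite -[X in k X](subKn jn).
  have : (n - j < n)%N by rewrite ltn_subrL j0.
  elim: (n - j)%N => [|m IH] mn; first by rewrite subn0 addn0 k0// n0 leqnn.
  rewrite addnS; apply: leq_ltn_trans (IH (ltnW mn)).
  have := kS (n - m.+1)%N; rewrite subn_gt0 mn ltn_subrL n0/= => /(_ isT).
  have -> : (n - m = (n - m.+1).+1)%N by lia.
  by move=> h; rewrite ltn_add2r.
have kE j : (0 < j <= n)%N -> (k j + n.+1 = k 0 + j)%N.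
  move=> jn; have h1 := k_le j jn; have h2 := k_ge j jn.
  by case/andP: jn => j0 jn; move: h1 h2 k1; move: (k j) (k 0) (k 1) => kj k0' k1'; lia.
have kE' j : (j <= n)%N -> (k j + (if j == 0 then 0 else n.+1) = k 0 + j)%N.
  by case: j => [|j] jn //=; rewrite kE.
have rho_le i : (rho i <= b + n.+1)%N.
  have [[|j] jn ->] := l_surj i; first by rewrite rho0 addnS.
  by rewrite rho_l// -addnS leq_add2l ltnW.
have sumx' : (\sum_i x n.+1 i = \sum_i z i + n.+1)%N.
  by rewrite big_split/=; congr addn; under eq_bigr do rewrite rho_le;
     rewrite sum_nat_const card_ord muln1.
have sumx : (\sum_i x n i = \sum_i z i + n)%N.
  rewrite big_split/=; congr addn; rewrite (bigD1 (l 0))//= rho0 -addnS leq_add2l ltnn add0n.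
  rewrite (eq_bigr (fun=> 1%N)) => [|i].
    by rewrite sum1_card cardC1 card_ord.
  have [[|j] jn ->] := l_surj i; first by rewrite eqxx.
  by rewrite rho_l// -addnS leq_add2l jn.
(* The sums before and after the last step differ by one and enclose the threshold, which fixes the
   initial sum; summing the consecutive keys then determines [k 0]. *)
have sumz : (\sum_i z i = n.+1 * M)%N by move: sum_lt sum_ge; rewrite sumx sumx' mulnS; lia.
have sumk : (\sum_(j < n.+1) k j = (\sum_i z i) * n.+1 + \sum_(i < n.+1) i)%N.
  have lB : injective (fun j : 'I_n.+1 => l j).
    by move=> i j /l_inj E; apply: val_inj; apply: E; rewrite -ltnS.
  by rewrite big_split/= -big_distrl/= [X in (_ = X * _ + _)%N](reindex_inj lB) [X in (_ = _ + X)%N](reindex_inj lB).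
have k0E : (k 0 = n.+1 * M + n)%N.
  have : (\sum_(j < n.+1) (k j + (if j == 0 :> nat then 0 else n.+1)) =
          \sum_(j < n.+1) (k 0 + j))%N by apply: eq_bigr => j _; rewrite kE'// -ltnS.
  rewrite [X in X = _]big_split [X in _ = X]big_split/= sumk sumz sum_nat_const card_ord.
  have -> : (\sum_(j < n.+1) (if j == 0 :> nat then 0 else n.+1) = n * n.+1)%N.
    by rewrite big_ord_recl/= sum_nat_const card_ord.
  move: (k 0) (\sum_(i < n.+1) i)%N => k0' S E; apply/eqP.
  by rewrite -(eqn_pmul2l (ltn0Sn n)); apply/eqP; lia.
have res j : (j <= n)%N -> z (l j) = M /\ nat_of_ord (l j) = (if j == 0 then n else j.-1).
  move=> jn; have := kE' j jn; rewrite k0E; case: j jn => [|j] jn /=.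
    rewrite !addn0 /k [(n.+1 * M)%N]mulnC => E.
    by have [-> ->] := @key_eq (z (l 0)) M (l 0) ord_max E.
  rewrite /k => E; have jp : (j < n.+1)%N by rewrite ltnW.
  have [] := @key_eq (z (l j.+1)) M (l j.+1) (Ordinal jp) _; first by move: E => /=; rewrite mulnC; lia.
  by move=> -> ->.
move=> i; have [j jn ->] := l_surj i; have [zM lE] := res j jn; split=> //.
by rewrite lE; case: j jn {zM lE} => [|j] jn /=; rewrite ?rho0 ?rho_l.
Qed.

Section Count.
Variables (n r G M0 : nat).
Local Notation p := n.+1.
Local Notation q := (r * p)%N.
Local Notation vertex := ('I_q.+1 -> nat).
Local Notation H := (p * M0.+1)%N.
Notation simplex := ({ffun 'I_q.+1 -> 'I_(M0.*2).+1} * 'S_q.+1)%type.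
Hypotheses (G3 : (3 <= G)%N) (n0 : (0 < n)%N).
Variable F : fieldType.
Local Notation ref := (@ref_label n r G).
Local Notation idx := (idx n r).

Lemma ref_label_max k u (i : 'I_p) : (u (idx k i) <= u (idx k (ref k u)))%N.
Proof. exact: (sel_max (fun i : 'I_p => u (idx k i))). Qed.

Lemma ref_label_key k (u : vertex) (i : 'I_p) : ~~ @spread n r G u ->
  (u (idx k i) * p + i <= u (idx k (ref k u)) * p + ref k u)%N.
Proof.
move=> ns; have := ref_label_max k u i; rewrite leq_eqVlt => /orP[/eqP E|lt]; last first.
  apply: leq_trans (_ : (u (idx k i)).+1 * p <= _)%N.
    by rewrite mulSn addnC leq_add2r ltnW.
  by apply: leq_trans (leq_addr _ _); rewrite leq_mul2r lt orbT.
rewrite E leq_add2l.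
have [+ smax] := selP (fun i : 'I_p => u (idx k i)) (fun i => if spread G u then column u i else 0%N).
rewrite -/(ref k u) inE => /andP[/forallP m1 _]; apply: smax.
rewrite inE (negbTE ns); apply/andP; split; apply/forallP => j; last by rewrite implybT.
by rewrite E; apply: m1.
Qed.

(** The one contributing simplex: it starts at the centre of the box and increments the coordinates
    in their natural order, the prism direction first. *)
Definition diag_simplex : simplex := ([ffun c => inord (if c == ord0 then 0 else M0)], 1%g).

Lemma diag_vertex j k (i : 'I_p) : (k < r)%N ->
  kuhn_vertex diag_simplex j (idx k i) = (M0 + (k * p + i < j.-1))%N.
Proof.
move=> kr; rewrite /kuhn_vertex /diag_simplex/= ffunE perm1 (negbTE (idx_neq0 _ _))//.
rewrite inordK ?idx_val//; last by rewrite ltnS -addnn leq_addr.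
by case: j.
Qed.

Lemma diag_euler_neq0 :
  euler_cochain H F ref (fun j => kuhn_vertex diag_simplex j.+1) != 0.
Proof.
apply/prodf_neq0 => k _; rewrite /block_cochain /cup mulf_eq0 negb_or /tailseq.
have vE j (i : 'I_p) : kuhn_vertex diag_simplex (k * p + j).+1 (idx k i) = (M0 + (i < j))%N.
  by rewrite diag_vertex//= ltn_add2l.
apply/andP; split; last first.
  rewrite /crossing /block_sum; under eq_bigr do rewrite addn1 vE ltn_ord addn1.
  rewrite sum_nat_const card_ord leqnn.
  under eq_bigr do rewrite addn0 vE.
  rewrite leqNgt; suff -> : (\sum_(i < p) (M0 + (i < n)) < p * M0.+1)%N by rewrite subr0 oner_eq0.
  rewrite big_ord_recr/= ltnn addn0; under eq_bigr do rewrite ltn_ord addn1.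
  by rewrite sum_nat_const card_ord; lia.
apply: label_det_neq0.
have ns j : ~~ @spread n r G (kuhn_vertex diag_simplex j).
  apply/existsP => -[k' /existsP[i1 /existsP[i2]]]; rewrite !diag_vertex//.
  by do 2 case: (_ < _)%N; lia.
have refE (j : 'I_p) : ref k (kuhn_vertex diag_simplex (k * p + j).+1) = inord (if j == 0 :> nat then n else j.-1).
  set t := inord _; apply/val_inj/eqP => /=.
  have tE : nat_of_ord t = (if j == 0 :> nat then n else j.-1).
    by rewrite inordK//; case: ifP => // _; rewrite (leq_ltn_trans (leq_pred _)).
  have := ref_label_key k t (ns (k * p + j).+1); rewrite !vE.
  have jp := ltn_ord j.
  set s := ref _ _; have sp := ltn_ord s; rewrite tE.
  case: (nat_of_ord j) jp => [|j'] jp /=; rewrite ?ltn0.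
    by rewrite !addn0 leq_add2l => ?; rewrite eqn_leq; lia.
  rewrite ltnSn; case: ltnP => [sj|sj]; rewrite ?addn0; first by rewrite leq_add2l; lia.
  by rewrite mulnDl; lia.
move=> i j; rewrite !refE => /(congr1 val)/=.
rewrite !inordK; last 2 first.
- by case: ifP => // _; rewrite (leq_ltn_trans (leq_pred _)).
- by case: ifP => // _; rewrite (leq_ltn_trans (leq_pred _)).
by move=> E; apply: val_inj => /=; move: E (ltn_ord i) (ltn_ord j); case: (nat_of_ord i) (nat_of_ord j) => [|?] [|?] /=; lia.
Qed.

(** All labels occur in a block, so each of its coordinates is maximal at some vertex; hence
    starting values differ by at most one, and values at a vertex by at most two. As [3 <= G], ties
    are broken by the index alone, and [rotation_unique] determines each block. *)
Lemma euler_diag_unique (s : simplex) : in_box (@extent n r M0) s -> first_dir s = ord0 ->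
  euler_cochain H F ref (fun j => kuhn_vertex s j.+1) != 0 -> s = diag_simplex.
Proof.
move=> bs s0 /(@euler_cochain_neq0 _ _ _ _ _ s 1) nz.
have inc j c : (s.1 c <= kuhn_vertex s j c <= (s.1 c).+1)%N.
  by rewrite /kuhn_vertex leq_addr/= -[X in (_ <= X)%N]addn1 leq_add2l leq_b1.
have flat k (i i' : 'I_p) : (k < r)%N -> (s.1 (idx k i') <= (s.1 (idx k i)).+1)%N.
  move=> kr; have [/injF_bij[g _ gK] _ _] := nz k kr.
  have := ref_label_max k (kuhn_vertex s (1 + (k * p + g i))) i'; rewrite gK => h.
  have /andP[h1 _] := inc (1 + (k * p + g i))%N (idx k i').
  have /andP[_ h2] := inc (1 + (k * p + g i))%N (idx k i).
  exact: leq_trans h1 (leq_trans h h2).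
have ns j : ~~ @spread n r G (kuhn_vertex s j).
  apply/existsP => -[k' /existsP[i1 /existsP[i2]]].
  have /andP[h1 _] := inc j (idx k' i1); have /andP[_ h2] := inc j (idx k' i2).
  by have := flat k' i1 i2 (ltn_ord k'); lia.
have key k : (k < r)%N -> forall i : 'I_p, s.1 (idx k i) = M0 :> nat /\ s.2 (idx k i) = (k * p + i).+1 :> nat.
  move=> kr; have [linj lo hi] := nz k kr.
  apply: (@rotation_unique n M0 (k * p) (fun i => s.1 (idx k i)) (fun i => s.2 (idx k i)) _ n0 linj).
  - by move=> i j /val_inj /perm_inj /idx_inj[]// _ /val_inj.
  - by move=> j i; have := ref_label_key k i (ns (1 + (k * p + j))%N).
  - by move: lo; congr (_ < _)%N; apply: eq_bigr => i _; rewrite /kuhn_vertex.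
  - by move: hi; congr (_ <= _)%N; apply: eq_bigr => i _; rewrite /kuhn_vertex.
have s1 : s.1 = diag_simplex.1.
  apply/ffunP => c; apply/val_inj; rewrite ffunE /=.
  case: eqVneq => [->|/idxP[k [i ->]]].
    by rewrite inordK//; move: bs => /forallP /(_ ord0); rewrite /extent eqxx ltnS leqn0 => /eqP.
  by rewrite inordK ?ltnS -?addnn ?leq_addr//; have [] := key k (ltn_ord k) i.
have s2 : s.2 = diag_simplex.2.
  apply/permP => c; rewrite /= perm1; have [->|/idxP[k [i ->]]] := eqVneq c ord0.
    by rewrite -[X in s.2 X]s0 permKV.
  by apply/val_inj; rewrite /= idx_val//; have [] := key k (ltn_ord k) i.
by rewrite [s]surjective_pairing s1 s2.
Qed.

Lemma ref_sum_neq0 : \sum_(s : simplex | in_box (@extent n r M0) s && (first_dir s == ord0))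
    (-1) ^+ s.2 * euler_cochain H F ref (fun j => kuhn_vertex s j.+1) != 0.
Proof.
have diagP : in_box (@extent n r M0) diag_simplex && (first_dir diag_simplex == ord0).
  apply/andP; split; last by rewrite /first_dir /= invg1 perm1.
  apply/forallP => c; rewrite ffunE /extent inordK; last by case: ifP; rewrite // ltnS -addnn leq_addr.
  by case: ifP => // _; rewrite ltnS -addnn leq_addr.
rewrite (bigD1 diag_simplex)//= odd_perm1 expr0 mul1r big1 ?addr0 ?diag_euler_neq0//.
move=> s /andP[/andP[bs /eqP s0]]; have [->|nz] := eqVneq (euler_cochain H F ref (fun j => kuhn_vertex s j.+1)) 0.
  by rewrite mulr0.
by rewrite (euler_diag_unique bs s0 nz) eqxx.
Qed.

End Count.

(** Put [L] at the bottom of the prism and the reference labelling at the top. The top sum is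
    nonzero, hence so is the bottom sum, and a simplex with nonzero cochain shows every label in
    each of its block windows. *)
Theorem rainbow_cell n r G (L : nat -> ('I_(r * n.+1).+1 -> nat) -> 'I_n.+1) :
  prime n.+1 -> (3 <= G)%N -> swap_equivariant G L ->
  exists u : 'I_(r * n.+1).+1 -> nat, (forall c, u c <= (n.+1 * G.+1).*2)%N /\
    forall k (i : 'I_n.+1), (k < r)%N ->
      exists2 w, (forall c, u c <= w c <= (u c).+1)%N & L k w = i.
Proof.
move=> np G3 Leq; set M0 := (n.+1 * G.+1)%N.
have n0 : (0 < n)%N by case: n np {L Leq M0} => [|n].
have pF : n.+1 \in [pchar 'F_n.+1] by apply: pchar_Fp.
have G0 : (0 < G)%N by apply: leq_trans G3.
have := @euler_cobordism n r G _ _ M0 pF erefl erefl _ _ Leq (@ref_label_swap n r G G0).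
have := @ref_sum_neq0 n r G M0 G3 n0 'F_n.+1.
set A := \sum_(s | _) _; set B := \sum_(s | _) _.
move=> A0 AB; have : B != 0.
  by apply: contra_neq A0 => B0; move: AB; rewrite B0 mulr0 addr0.
move=> /eqP B0; have [s _ nz] : exists2 s, true &
    euler_cochain (n.+1 * M0.+1) 'F_n.+1 L (kuhn_vertex (s : {ffun 'I_(r * n.+1).+1 -> 'I_M0.*2.+1} * 'S__)) != 0.
  apply: contrapT => none; apply: B0; apply: big1 => s _.
  by have [->|nz] := eqVneq (euler_cochain (n.+1 * M0.+1) 'F_n.+1 L (kuhn_vertex s)) 0; rewrite ?mulr0//; case: none; exists s.
exists (fun c => s.1 c); split=> [c|k i kr]; first by rewrite -ltnS.
have [/injF_bij[g _ gK] _ _] := @euler_cochain_neq0 _ _ _ _ _ s 0 _ nz k kr.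
exists (kuhn_vertex s (0 + (k * n.+1 + g i))); last exact: gK.
by move=> c; rewrite /kuhn_vertex leq_addr/= -[X in (_ <= X)%N]addn1 leq_add2l leq_b1.
Qed.

From mathcomp Require Import all_classical all_reals all_analysis measurable_realfun.
Import numFieldNormedType.Exports.
Local Open Scope classical_set_scope.
Local Open Scope ring_scope.

(** * Null sets of quadrics *)

Section NullSets.
Variable R : realType.

Lemma box_vol_ge0 d (a b : d.-tuple R) : 0 <= box_vol a b.
Proof. by apply: prodr_ge0 => i _; rewrite le_max lexx. Qed.

Lemma finite_cover_null d (N : set (d.-tuple R)) : (0 < d)%N ->
  (forall eps : R, 0 < eps -> exists (I : finType) (a b : I -> d.-tuple R),
     (forall x, N x -> exists i, box (a i) (b i) x) /\
     \sum_i box_vol (a i) (b i) <= eps) ->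
  lebesgue_null N.
Proof.
move=> d0 cover eps /cover[I [a [b [Ncov vol]]]].
(* The finite family is padded with a single point, a box of volume zero since [0 < d]. *)
pose ext (c : I -> d.-tuple R) (k : nat) : d.-tuple R :=
  if insub k is Some j then c (fintype.enum_val (j : 'I_#|I|)) else [tuple 0 | i < d].
exists (ext a), (ext b); split.
  move=> x /Ncov[i bi]; exists (fintype.enum_rank i) => //.
  by rewrite /ext valK fintype.enum_rankK.
move=> n; apply: le_trans vol.
pose f k := box_vol (ext a k) (ext b k).
apply: (@le_trans _ _ (\sum_(k < maxn n #|I|) f k)).
  rewrite -!(big_mkord xpredT f) (big_cat_nat (leq0n n) (leq_maxl n #|I|))/=.
  by rewrite lerDl sumr_ge0// => k _; apply: box_vol_ge0.
rewrite -(big_mkord xpredT f) (big_cat_nat (leq0n #|I|) (leq_maxr n #|I|))/=.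
rewrite [X in _ + X]big_nat_cond [X in _ + X]big1 => [|k /andP[/andP[Ik _] _]]; last first.
  rewrite /f /ext insubF; last by rewrite ltnNge Ik.
  rewrite /box_vol (bigD1 (Ordinal d0))//= !tnth_mktuple subrr.
  by rewrite (_ : Num.max 0 0 = 0) ?mul0r//; apply/max_idPl.
rewrite addr0 big_mkord [leRHS](reindex _ (onW_bij _ (@fintype.enum_val_bij I)))/=.
by apply: ler_sum => j _; rewrite /f /ext valK.
Qed.

(** The point is that [delta] does not depend on [c]. If [s != 0], completing the square around [m]
    gives [w ^+ 2 <= (z - m) ^+ 2 <= w ^+ 2 + e ^+ 2], hence [w <= |z - m| <= w + e]; a negative
    radicand makes [w] zero. *)
Lemma quadratic_slab (s a e : R) : (s != 0) || (a != 0) -> 0 < e ->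
  exists2 delta, 0 < delta & forall c, exists l : R * R, forall z,
    `|s * z ^+ 2 + a * z + c| <= delta ->
    l.1 <= z <= l.1 + e \/ l.2 <= z <= l.2 + e.
Proof.
move=> sa e0; have [s0|s0] := eqVneq s 0.
  have a0 : a != 0 by move: sa; rewrite s0 eqxx.
  exists (`|a| * e / 2); first by rewrite divr_gt0// mulr_gt0// normr_gt0.
  move=> c; exists (- c / a - e / 2, 0) => z; rewrite s0 mul0r add0r => h; left => /=.
  have : `|z + c / a| <= e / 2.
    rewrite -(ler_pM2l (_ : 0 < `|a|)) ?normr_gt0// -normrM mulrDr mulrCA divff// mulr1.
    by rewrite mulrA.
  by rewrite ler_norml => /andP[h1 h2]; apply/andP; split; lra.
exists (`|s| * (e ^+ 2 / 2)); first by rewrite mulr_gt0 ?normr_gt0// divr_gt0// exprn_gt0.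
move=> c; pose m := - (a / (2 * s)); pose D := m ^+ 2 - c / s.
pose w := Num.sqrt (D - e ^+ 2 / 2).
have w0 : 0 <= w by apply: sqrtr_ge0.
exists (m + w, m - w - e) => z h /=.
have {h} : `|(z - m) ^+ 2 - D| <= e ^+ 2 / 2.
  rewrite -(ler_pM2l (_ : 0 < `|s|)) ?normr_gt0// -normrM.
  rewrite (_ : s * _ = s * z ^+ 2 + a * z + c)// /D /m.
  by field.
rewrite ler_distl => /andP[lo hi].
have w2 : w ^+ 2 <= (z - m) ^+ 2.
  have [Dn|Dp] := lerP 0 (D - e ^+ 2 / 2); first by rewrite sqr_sqrtr//.
  by have -> : w = 0 by [rewrite /w ler0_sqrtr ?ltW//]; have := sqr_ge0 (z - m); lra.
have w3 : (z - m) ^+ 2 <= w ^+ 2 + e ^+ 2.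
  have [Dn|Dp] := lerP 0 (D - e ^+ 2 / 2); first by rewrite sqr_sqrtr//; lra.
  by have -> : w = 0 by [rewrite /w ler0_sqrtr ?ltW//]; lra.
have root y : 0 <= y -> w ^+ 2 <= y ^+ 2 -> y ^+ 2 <= w ^+ 2 + e ^+ 2 -> w <= y <= w + e.
  move=> y0 wy yw; rewrite -ler_sqr ?nnegrE// wy/= -ler_sqr ?nnegrE ?addr_ge0 ?(ltW e0)//.
  by have := mulr_ge0 w0 (ltW e0); lra.
have [zm|zm] := lerP 0 (z - m); [left|right].
  by have /andP[h1 h2] := root _ zm w2 w3; apply/andP; split; lra.
have zm' : 0 <= m - z by lra.
rewrite -[(z - m) ^+ 2]sqrrN opprB in w2 w3.
by have /andP[h1 h2] := root _ zm' w2 w3; apply/andP; split; lra.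
Qed.

Lemma grid_cell (n : nat) (r x : R) : 0 < r -> - r <= x <= r ->
  exists m : 'I_n.+1, - r + m%:R * (2 * r / n.+1%:R) <= x <= - r + m.+1%:R * (2 * r / n.+1%:R).
Proof.
move=> r0 /andP[xl xr]; set h := 2 * r / n.+1%:R.
have h0 : 0 < h by rewrite divr_gt0// mulr_gt0.
have hn : h * n.+1%:R = 2 * r by rewrite divfK// pnatr_eq0.
pose t := (x + r) / h; have t0 : 0 <= t by apply: divr_ge0; [lra|exact: ltW].
have th : t * h = x + r by rewrite divfK// gt_eqF.
have /andP[lo hi] := truncn_itv t0.
have [le|gt] := leqP (Num.truncn t) n.
  exists (Ordinal (le : (Num.truncn t < n.+1)%N)) => /=.
  rewrite -(ler_pM2r h0) th in lo; rewrite -(ltr_pM2r h0) th in hi.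
  by apply/andP; split; lra.
exists ord_max => /=; have : n.+1%:R <= t by apply: le_trans lo; rewrite ler_nat.
rewrite -(ler_pM2r h0) th -natr1 mulrDl mul1r => h1.
move: hn; rewrite -natr1 mulrDr mulr1 mulrC => h2.
by apply/andP; split; lra.
Qed.

Definition quadric d (s : R) (a : 'I_d -> R) (b : R) (x : d.-tuple R) : R :=
  s * (\sum_i tnth x i ^+ 2) + \sum_i a i * tnth x i + b.

(* Over each cell of a fine grid in the other coordinates, the zero set lies in
   two thin slabs in direction [i]. *)
Lemma quadric_null d (s : R) (a : 'I_d -> R) b (r : R) (i : 'I_d) : 0 < r -> (s != 0) || (a i != 0) ->
  lebesgue_null [set x | quadric s a b x = 0 /\ forall j, - r <= tnth x j <= r].
Proof.
move=> r0 sa; apply: finite_cover_null => [|eps eps0]; first exact: leq_ltn_trans (ltn_ord i).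
pose V : R := \prod_(j < d | j != i) (2 * r).
have V0 : 0 < V by apply: prodr_gt0 => j _; rewrite mulr_gt0.
(* Two slabs of width [e] over a base of volume [V] have total volume [eps]. *)
pose e := eps / (2 * V); have e0 : 0 < e by rewrite divr_gt0// mulr_gt0.
have [delta delta0 slab] := quadratic_slab sa e0.
have [l lP] := choice slab.
(* [L] bounds the change of the polynomial when the other coordinates move by at most one unit each
   inside the cube, so a mesh [h] with [h * L <= delta] allows replacing them by a grid corner. *)
pose L : R := \sum_j (`|s| * (2 * r) + `|a j|).
have [n nP] : exists n : nat, (2 * r / n.+2%:R) * L <= delta.
  pose t := 2 * r * L / delta.
  exists (Num.truncn t); have : t < (Num.truncn t).+2%:R.
    by apply: lt_trans (truncnS_gt t) _; rewrite ltr_nat.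
  by rewrite /t ltr_pdivrMr// => h; rewrite mulrAC ler_pdivrMr ?ltr0n// [delta * _]mulrC ltW.
set h := 2 * r / n.+2%:R in nP.
have h0 : 0 < h by rewrite divr_gt0// mulr_gt0.
pose corner (f : {ffun 'I_d -> 'I_n.+2}) j : R := - r + (f j)%:R * h.
pose c f := \sum_(j < d | j != i) (s * corner f j ^+ 2 + a j * corner f j) + b.
(* In direction [i] the index only selects a slab: 0 and 1 stand for the two slabs, all further
   values give boxes of length zero. The mesh count [n.+2] ensures that both indices exist. *)
pose lo (f : {ffun 'I_d -> 'I_n.+2}) : d.-tuple R := [tuple
  if j != i then corner f j else if f i == 0 :> nat then (l (c f)).1
  else if f i == 1 :> nat then (l (c f)).2 else 0 | j < d].
pose len (j : 'I_d) (m : 'I_n.+2) : R := if j != i then h else if (m < 2)%N then e else 0.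
pose hi f : d.-tuple R := [tuple tnth (lo f) j + len j (f j) | j < d].
have len0 j m : 0 <= len j m by rewrite /len; case: ifP => _; [exact: ltW|case: ifP => // _; exact: ltW].
exists {ffun 'I_d -> 'I_n.+2}, lo, hi; split; last first.
  have volE f : box_vol (lo f) (hi f) = \prod_j len j (f j).
    by apply: eq_bigr => j _; rewrite tnth_mktuple [X in X - _]addrC addrK; apply/max_idPr.
  rewrite (eq_bigr _ (fun f _ => volE f)) -(bigA_distr_bigA len)/=.
  rewrite (bigD1 i)//= [X in X * _](_ : _ = 2 * e); last first.
    rewrite !big_ord_recl/= /len eqxx/= big1 ?addr0 => [|m _]; last by [].
    by rewrite mulr2n mulrDl mul1r.
  rewrite (eq_bigr (fun=> 2 * r)) => [|j ji]; last first.
    rewrite /len ji sumr_const card_ord -[LHS]mulr_natr /h.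
    by rewrite divfK// pnatr_eq0.
  by rewrite -/V /e mulrCA invfM; rewrite le_eqVlt; apply/orP; left; apply/eqP; field; rewrite gt_eqF.
move=> x /= [qx xr].
have [f0 f0P] := choice (fun j => grid_cell n.+1 r0 (xr j)).
pose fm m : {ffun 'I_d -> 'I_n.+2} := [ffun j => if j == i then m else f0 j].
have fmj m j : j != i -> fm m j = f0 j by move=> ji; rewrite ffunE (negbTE ji).
have fmi m : fm m i = m by rewrite ffunE eqxx.
have cE m m' : c (fm m) = c (fm m').
  by congr (_ + _); apply: eq_bigr => j ji; rewrite /corner !fmj.
pose m0 : 'I_n.+2 := ord0; pose m1 : 'I_n.+2 := Ordinal (isT : 1 < n.+2)%N.
have near : `|s * tnth x i ^+ 2 + a i * tnth x i + c (fm m0)| <= delta.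
  have -> : s * tnth x i ^+ 2 + a i * tnth x i + c (fm m0) =
     \sum_(j < d | j != i) (s * (corner (fm m0) j ^+ 2 - tnth x j ^+ 2) + a j * (corner (fm m0) j - tnth x j)).
    rewrite -[LHS]subr0 -[X in _ - X]qx /quadric mulr_sumr (bigD1 i)//= [X in _ - (_ + X + _)](bigD1 i)//=.
    rewrite /c.
    rewrite [RHS](eq_bigr (fun j => (s * corner (fm m0) j ^+ 2 + a j * corner (fm m0) j) -
       (s * tnth x j ^+ 2 + a j * tnth x j))) => [|j _]; last by ring.
    by rewrite sumrB [X in _ = _ - X]big_split/=; ring.
  apply: le_trans nP; apply: le_trans (ler_norm_sum _ _ _) _.
  rewrite mulr_sumr; apply: (@le_trans _ _ (\sum_(j < d | j != i) h * (`|s| * (2 * r) + `|a j|))).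
    apply: ler_sum => j ji.
    have /andP[x1 x2] := f0P j; have /andP[x3 x4] := xr j.
    rewrite -/h in x1 x2; rewrite /corner fmj//.
    have {}x1 : corner (fm m0) j <= tnth x j by rewrite /corner fmj.
    rewrite /corner fmj// in x1; set y := - r + _ in x1 *; have xy : `|y - tnth x j| <= h.
      by rewrite ler_norml; move: x1 x2; rewrite -natr1 mulrDl mul1r addrA -/y => ? ?; apply/andP; split; lra.
    have y1 : - r <= y by rewrite /y lerDl mulr_ge0// ltW.
    have xy' : `|y + tnth x j| <= 2 * r by rewrite ler_norml; apply/andP; split; lra.
    rewrite subr_sqr mulrA mulrAC -mulrDl mulrC normrM; apply: ler_pM => //.
    by apply: le_trans (ler_normD _ _) _; rewrite lerD2r normrM ler_wpM2l.
  rewrite [leRHS](bigD1 i)//= lerDr; apply: mulr_ge0; first exact: ltW.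
  by rewrite addr_ge0// !mulr_ge0// ltW.
have corner_box m j : j != i -> tnth (lo (fm m)) j <= tnth x j <= tnth (hi (fm m)) j.
  move=> ji; rewrite !tnth_mktuple /len ji /corner fmj//.
  by have := f0P j; rewrite -/h -natr1 mulrDl mul1r addrA.
case: (lP _ _ near) => lx; [exists (fm m0)|exists (fm m1)] => j;
  (have [->|ji] := eqVneq j i; last exact: corner_box);
  rewrite !tnth_mktuple /len eqxx/= !fmi//=.
by rewrite (cE m1 m0).
Qed.

End NullSets.

(** Dominated convergence for indicator functions, with the constant 1 as bound. *)
Lemma cvg_measure_ae (disp : measure_display) (T : measurableType disp) (R : realType)
    (mu : {measure set T -> \bar R}) (A_ : nat -> set T) (A N : set T) :
  (mu setT < +oo)%E -> (forall n, measurable (A_ n)) -> measurable A ->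
  measurable N -> mu N = 0%E ->
  (forall x, ~ N x -> \forall n \near \oo, A_ n x <-> A x) ->
  mu (A_ n) @[n --> \oo] --> mu A.
Proof.
move=> fin mA_ mA mN N0 lim.
have indE (B : set T) : measurable B -> mu B = (\int[mu]_(x in setT) (\1_B x)%:E)%E.
  by move=> mB; rewrite integral_indic// setIT.
have mind (B : set T) : measurable B -> measurable_fun setT (EFin \o (\1_B : T -> R)).
  by move=> mB; apply/measurable_EFinP; apply: measurable_indic.
have [] := @dominated_convergence _ T R mu setT measurableT
  (fun n x => (\1_(A_ n) x)%:E) (fun x => (\1_A x)%:E) (cst 1%E).
- by move=> n; apply: mind.
- exact: mind.
- exists N; split=> // x; apply: contra_notP => Nx _.
  apply: cvg_near_cst; apply: filterS (lim x Nx) => n AAn.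
  by rewrite !indicE; have -> : (x \in A_ n) = (x \in A) by apply/idP/idP; rewrite !inE => /AAn.
- by apply/integrableP; split=> //; rewrite integral_cst//= normr1 mul1e.
- by apply: aeW => x n _; rewrite /= lee_fin indicE ger0_norm// lern1 leq_b1.
move=> _ _; rewrite (indE _ mA).
by under eq_fun do rewrite -indE//.
Qed.

Section Quadrics.
Variables (R : realType) (d : nat).

Lemma measurable_quadric s (a : 'I_d -> R) b : measurable_fun setT (quadric s a b).
Proof.
apply: measurable_funD => //; apply: measurable_funD.
  apply: measurable_funM => //; apply: measurable_sum => i.
  by apply: measurable_funX; apply: measurable_tnth.
by apply: measurable_sum => i; apply: measurable_funM => //; apply: measurable_tnth.
Qed.

Lemma quadric_zero_measurable s (a : 'I_d -> R) b : measurable [set x | quadric s a b x = 0].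
Proof.
rewrite (_ : [set x | _] = setT `&` (quadric s a b) @^-1` [set 0]).
  by apply: (measurable_quadric s a b) => //; apply: measurable_set1.
by apply/seteqP; split => x /=; tauto.
Qed.

Lemma quadric_pos_measurable s (a : 'I_d -> R) b : measurable [set x | 0 < quadric s a b x].
Proof.
rewrite (_ : [set x | _] = setT `&` (quadric s a b) @^-1` `]0, +oo[).
  by apply: (measurable_quadric s a b) => //; apply: measurable_itv.
by apply/seteqP; split => x /=; rewrite in_itv/= andbT; tauto.
Qed.

Lemma abs_cont_quadric (mu : {measure set (d.-tuple R) -> \bar R}) s (a : 'I_d -> R) b :
  abs_cont mu -> [|| s != 0, [exists i, a i != 0] | b != 0] ->
  (0 < d)%N -> mu [set x | quadric s a b x = 0] = 0%E.
Proof.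
move=> ac nz d0; have [/existsP[i sa]|] := boolP [exists i : 'I_d, (s != 0) || (a i != 0)]; last first.
  move=> /existsPn h; have s0 : s = 0 by have := h (Ordinal d0); rewrite negb_or negbK => /andP[/eqP].
  have a0 i : a i = 0 by have := h i; rewrite negb_or negbK => /andP[_]; rewrite negbK => /eqP.
  have b0 : b != 0.
    by case/or3P: nz => // [|/existsP[i]]; rewrite ?s0 ?a0 eqxx.
  rewrite (_ : [set x | _] = set0) ?measure0//; apply/seteqP; split=> x //=.
  rewrite /quadric s0 mul0r add0r big1 ?add0r => [/eqP|i _]; first by rewrite (negbTE b0).
  by rewrite a0 mul0r.
pose Z k := [set x | quadric s a b x = 0 /\ forall j, - k.+1%:R <= tnth x j <= k.+1%:R].
have mZ k : measurable (Z k).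
  rewrite (_ : Z k = [set x | quadric s a b x = 0] `&`
    \bigcap_(j in [set: 'I_d]) [set x | - k.+1%:R <= tnth x j <= k.+1%:R]).
    apply: measurableI; first exact: quadric_zero_measurable.
    apply: fin_bigcap_measurable => // j _; rewrite -[X in measurable X]setTI.
    rewrite (_ : _ `&` _ = setT `&` (fun x : d.-tuple R => tnth x j) @^-1` `[- k.+1%:R, k.+1%:R]).
      by apply: measurable_tnth.
    by apply/seteqP; split => x /=; rewrite in_itv/=.
  by apply/seteqP; split => x /= [? h]; split=> // j; [move=> _; apply: h|apply: h].
have Z0 k : mu (Z k) = 0%E by apply: ac => //; apply: quadric_null sa; rewrite ltr0n.
rewrite (_ : [set x | _] = \bigcup_k Z k); last first.
  apply/seteqP; split => x /=; last by move=> [k _ []].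
  move=> qx; pose M := \sum_j `|tnth x j|.
  exists (Num.truncn M) => //; split=> // j; rewrite -ler_norml.
  apply: le_trans (ltW (truncnS_gt M)).
  by rewrite /M (bigD1 j)//= lerDl sumr_ge0.
apply: measure_negligible; first exact: bigcup_measurable.
by apply: negligible_bigcup => k; exists (Z k); split.
Qed.

Lemma quadricB s (a : 'I_d -> R) b s' a' b' x : quadric s a b x - quadric s' a' b' x =
  quadric (s - s') (fun i => a i - a' i) (b - b') x.
Proof.
rewrite /quadric; have -> : \sum_i (a i - a' i) * tnth x i =
  \sum_i a i * tnth x i - \sum_i a' i * tnth x i.
  by rewrite -sumrB; apply: eq_bigr => i _; rewrite mulrBl.
by ring.
Qed.

End Quadrics.

(** * Power-diagram cells *)

Section Cells.
Variables (R : realType) (d n : nat).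
Local Notation p := n.+1.
Implicit Types (y : 'I_d.+1 -> 'I_p -> R) (i j : 'I_p) (x : d.-tuple R).

(* The constant: a gap [G] on a grid of size [2 p (G + 1) + 1] is at least [1 / (4 p)] after rescaling. *)
Definition closeness y i j : R := \prod_(k < d.+1) Num.max 0 (1 - (4 * p)%:R * `|y k i - y k j|).

(* If [i] and [j] have the same [y], this separates their pieces; but it ignores pairs that are far apart,
   so that it is compatible with swapping them. *)
Definition soft_rank y i : R := \sum_(j < p | (j < i)%N) closeness y i j.

Definition piece y i x : R :=
  quadric (y ord_max i) (fun l => y (widen_ord (leqnSn d) l) i) (soft_rank y i) x.

Definition cell y i : set (d.-tuple R) := [set x | forall j, j != i -> piece y j x < piece y i x].

Lemma closeness_ge0 y i j : 0 <= closeness y i j.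
Proof. by apply: prodr_ge0 => k _; rewrite le_max lexx. Qed.

Lemma closeness_eq0 y i j k : 1 <= (4 * p)%:R * `|y k i - y k j| -> closeness y i j = 0.
Proof.
move=> h; rewrite /closeness (bigD1 k)//= (_ : Num.max _ _ = 0) ?mul0r//.
by apply/max_idPl; lra.
Qed.

Lemma pieceB y i j x : piece y i x - piece y j x =
  quadric (y ord_max i - y ord_max j)
    (fun l => y (widen_ord (leqnSn d) l) i - y (widen_ord (leqnSn d) l) j)
    (soft_rank y i - soft_rank y j) x.
Proof. exact: quadricB. Qed.

(** If all coefficients of [i < j] agree, then so do their closenesses to every index, but the rank
    of [j] has the additional positive summand [closeness y j i]. *)
Lemma pieces_distinct y i j : i != j ->
  [|| y ord_max i - y ord_max j != 0,
   [exists l : 'I_d, y (widen_ord (leqnSn d) l) i - y (widen_ord (leqnSn d) l) j != 0] |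
   soft_rank y i - soft_rank y j != 0].
Proof.
wlog ij : i j / (i < j)%N => [hw ne|_].
  have [ij|ji|/val_inj E] := ltngtP i j; first exact: hw.
    have := hw j i ji; rewrite eq_sym ne => /(_ isT).
    rewrite -opprB oppr_eq0 -[soft_rank y j - _]opprB oppr_eq0; congr [|| _, _ | _].
    by apply: eq_existsb => l; rewrite -opprB oppr_eq0.
  by rewrite E eqxx in ne.
have [//|/negPn/eqP eM] := boolP (y ord_max i - y ord_max j != 0).
have [//|/existsPn h] :=
  boolP [exists l : 'I_d, y (widen_ord (leqnSn d) l) i - y (widen_ord (leqnSn d) l) j != 0].
have yE k : y k i = y k j.
  apply/eqP; rewrite -subr_eq0; apply/eqP.
  case: (unliftP ord_max k) => [l ->|->//].
  have -> : lift ord_max l = widen_ord (leqnSn d) l by apply: val_inj; exact: lift_max.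
  by have := h l; rewrite negbK => /eqP.
have cE l : closeness y i l = closeness y j l by apply: eq_bigr => k _; rewrite yE.
rewrite /= lt_eqF// subr_lt0 /soft_rank.
rewrite [ltRHS](bigID (fun l : 'I_p => (l < i)%N))/=.
rewrite (eq_bigr (closeness y j)) => [|l _]; last exact: cE.
rewrite [X in _ < X + _](eq_bigl (fun l : 'I_p => (l < i)%N)) => [|l]; last first.
  by rewrite andbC; case: (ltnP l i) => // li; rewrite (ltn_trans li ij).
rewrite ltrDl (bigD1 i)/=; last by rewrite ij ltnn.
apply: ltr_pwDl; last by apply: sumr_ge0 => l _; apply: closeness_ge0.
rewrite /closeness prodr_gt0// => k _.
by rewrite yE subrr normr0 mulr0 subr0 lt_max ltr01 orbT.
Qed.

(** The swap changes the index order only between the two swapped indices, and the corresponding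
    summand of [soft_rank] is zero because they are far apart. *)
Lemma piece_swap y (i0 : nat) k : (i0 < n)%N ->
  1 <= (4 * p)%:R * `|y k (inord i0) - y k (inord i0.+1)| ->
  forall i, piece (fun k j => y k (adj_swap n i0 j)) i = piece y (adj_swap n i0 i).
Proof.
move=> lin h i; set s := adj_swap n i0; rewrite /piece; congr (quadric _ _ _).
rewrite /soft_rank [LHS]big_mkcond [RHS]big_mkcond (reindex_inj (@perm_inj _ s)).
apply: eq_bigr => l _.
have -> : closeness (fun k j => y k (s j)) i (s l) = closeness y (s i) l.
  by apply: eq_bigr => m _; rewrite /s adj_swapK.
have sK : s (s i) = i by rewrite /s adj_swapK.
have iv : nat_of_ord (inord i0 : 'I_p) = i0 by rewrite inordK// ltnS ltnW.
have iv1 : nat_of_ord (inord i0.+1 : 'I_p) = i0.+1 by rewrite inordK.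
move: (s i) sK => a <-; rewrite /s /adj_swap.
have c0 : closeness y (inord i0) (inord i0.+1) = 0 by apply: closeness_eq0 h.
have c0' : closeness y (inord i0.+1) (inord i0) = 0.
  by apply: (@closeness_eq0 _ _ _ k); rewrite distrC.
case: (tpermP _ _ l) => [->|->|/eqP l0 /eqP l1];
  case: (tpermP _ _ a) => [->|->|/eqP a0 /eqP a1]; rewrite ?ltnn ?c0 ?c0' ?if_same//.
- rewrite iv iv1; congr (if _ then _ else _).
  by rewrite [RHS]leq_eqVlt; move: a1; rewrite -val_eqE/= iv1 eq_sym => /negbTE ->.
- rewrite iv iv1; congr (if _ then _ else _).
  by rewrite [LHS]leq_eqVlt; move: a1; rewrite -val_eqE/= iv1 eq_sym => /negbTE ->.
- rewrite iv iv1 ltnS leq_eqVlt; congr (if _ then _ else _).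
  by move: l0; rewrite -val_eqE/= iv => /negbTE ->.
- rewrite iv iv1 ltnS [(l <= i0)%N]leq_eqVlt; congr (if _ then _ else _).
  by move: l0; rewrite -val_eqE/= iv => /negbTE ->.
Qed.

Lemma cell_swap y (i0 : nat) k : (i0 < n)%N ->
  1 <= (4 * p)%:R * `|y k (inord i0) - y k (inord i0.+1)| ->
  forall i, cell (fun k j => y k (adj_swap n i0 j)) i = cell y (adj_swap n i0 i).
Proof.
move=> lin h i; apply/seteqP; split => x /= cx j ji.
  rewrite -(piece_swap lin h i) -[j](adj_swapK i0) -(piece_swap lin h); apply: cx.
  by apply: contra_neq ji => <-; rewrite adj_swapK.
by rewrite !(piece_swap lin h); apply: cx; rewrite (inj_eq (@perm_inj _ _)).
Qed.

Lemma measurable_cell y i : measurable (cell y i).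
Proof.
rewrite (_ : cell y i = \bigcap_(j in [set j | j != i]) [set x | 0 < piece y i x - piece y j x]).
  apply: fin_bigcap_measurable => [|j _]; first exact: finite_finset.
  rewrite (_ : [set x | _] = [set x | 0 < quadric (y ord_max i - y ord_max j)
    (fun l => y (widen_ord (leqnSn d) l) i - y (widen_ord (leqnSn d) l) j)
    (soft_rank y i - soft_rank y j) x]); first exact: quadric_pos_measurable.
  by apply/seteqP; split => x /=; rewrite pieceB.
by apply/seteqP; split => x h j ji; have := h j ji; rewrite /= subr_gt0.
Qed.

Definition ties y : set (d.-tuple R) :=
  \bigcup_(ij in [set ij : 'I_p * 'I_p | ij.1 != ij.2]) [set x | piece y ij.1 x - piece y ij.2 x = 0].

Let tieE y i j : [set x | piece y i x - piece y j x = 0] =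
  [set x | quadric (y ord_max i - y ord_max j)
    (fun l => y (widen_ord (leqnSn d) l) i - y (widen_ord (leqnSn d) l) j)
    (soft_rank y i - soft_rank y j) x = 0].
Proof. by apply/seteqP; split => x /=; rewrite pieceB. Qed.

Lemma measurable_ties y : measurable (ties y).
Proof.
apply: fin_bigcup_measurable => [|ij _]; first exact: finite_finset.
by rewrite tieE; apply: quadric_zero_measurable.
Qed.

Variable mu : {measure set (d.-tuple R) -> \bar R}.
Hypotheses (d0 : (0 < d)%N) (ac : abs_cont mu).

Lemma ties_null y : mu (ties y) = 0%E.
Proof.
apply: measure_negligible; first exact: measurable_ties.
pose F (m : nat) : set (d.-tuple R) := if unpickle m is Some ij then
  if ij.1 != ij.2 :> 'I_p then [set x | piece y ij.1 x - piece y ij.2 x = 0] else set0 else set0.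
apply: (@negligibleS _ _ _ mu (\bigcup_m F m)) => [x [ij /= ne xij]|].
  by exists (pickle ij) => //; rewrite /F pickleK ne.
apply: negligible_bigcup => m; rewrite /F.
case: (unpickle m) => [[i j]|] /=; last exact: negligible_set0.
case: ifPn => [ij|_]; last exact: negligible_set0.
rewrite tieE; apply/negligibleP; first exact: quadric_zero_measurable.
by apply: abs_cont_quadric => //; apply: pieces_distinct.
Qed.

Lemma cells_trivIset y : trivIset setT (cell y).
Proof.
apply/trivIsetP => i j _ _ ij; apply/seteqP; split=> x //= [ci cj].
by have := lt_trans (ci j _) (cj i ij); rewrite ltxx eq_sym ij => /(_ isT).
Qed.

Lemma cells_cover y x : ~ ties y x -> exists i, cell y i x.
Proof.
move=> nt; have [i _ imax] := @Order.TotalTheory.arg_maxP _ _ _ (ord0 : 'I_p) xpredT (fun i => piece y i x) isT.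
exists i => j ji /=; rewrite lt_neqAle; apply/andP; split; last exact: imax.
by apply: contra_notN nt => /eqP E; exists (j, i) => //=; rewrite E subrr.
Qed.

Lemma sum_cells y : (\sum_i mu (cell y i) = mu setT)%E.
Proof.
rewrite -(@measure_bigsetU_ord _ _ _ mu _ xpredT)//; last 2 first.
- by move=> i; apply: measurable_cell.
- exact: cells_trivIset.
set U := \big[setU/set0]_(i < p) _.
have mU : measurable U by apply: bigsetU_measurable => i _; apply: measurable_cell.
transitivity (mu (U `|` ties y)).
  by apply/esym/measureU0 => //; [exact: measurable_ties|exact: ties_null].
congr (mu _); apply/seteqP; split=> // x _.
have [nt|nt] := pselect (ties y x); [by right|left].
have [i ci] := cells_cover nt; rewrite /U -bigcup_mkord_ord.
by exists i => //=; rewrite inord_val.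
Qed.

(** Off the null set of ties of the limit, membership in a cell is decided by finitely many strict
    inequalities between functions continuous in [y], which persist near the limit. *)
Lemma cell_cvg (y_ : nat -> 'I_d.+1 -> 'I_p -> R) y i : (mu setT < +oo)%E ->
  (forall k j, y_ m k j @[m --> \oo] --> y k j) ->
  mu (cell (y_ m) i) @[m --> \oo] --> mu (cell y i).
Proof.
move=> fin yy; apply: (cvg_measure_ae fin) (ties_null y) _ => //.
- by move=> m; apply: measurable_cell.
- exact: measurable_cell.
- exact: measurable_ties.
have max_cvg (u : nat -> R) (a : R) : u m @[m --> \oo] --> a ->
    Num.max 0 (u m) @[m --> \oo] --> Num.max 0 a.
  move=> ua; under eq_cvg do rewrite maxr_absE add0r sub0r normrN.
  by rewrite maxr_absE add0r sub0r normrN; apply: cvgMr_tmp; apply: cvgD => //; apply: cvg_norm.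
have close_cvg j l : closeness (y_ m) j l @[m --> \oo] --> closeness y j l.
  apply: cvg_big => [|k _]; first exact: mul_continuous.
  apply: max_cvg; apply: cvgB; first exact: cvg_cst.
  by apply: cvgMl_tmp; apply: cvg_norm; apply: cvgB; apply: yy.
have rank_cvg j : soft_rank (y_ m) j @[m --> \oo] --> soft_rank y j.
  by apply: cvg_big => [|k _]; [exact: add_continuous|exact: close_cvg].
have piece_cvg j x : piece (y_ m) j x @[m --> \oo] --> piece y j x.
  apply: cvgD; last exact: rank_cvg.
  apply: cvgD; first by apply: cvgMr_tmp; apply: yy.
  by apply: cvg_big => [|k _]; [exact: add_continuous|apply: cvgMr_tmp; exact: yy].
have lt_near j l x : piece y j x < piece y l x ->
    \forall m \near \oo, piece (y_ m) j x < piece (y_ m) l x.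
  move=> lt; have lim := cvgB (piece_cvg l x) (piece_cvg j x).
  have pos : 0 < piece y l x - piece y j x by rewrite subr_gt0.
  near=> m; rewrite -subr_gt0; near: m.
  exact: (cvgr_gt _ (lim _) _ pos).
move=> x nt; have [ci|nci] := pselect (cell y i x).
  have : \forall m \near \oo, forall j, j != i -> piece (y_ m) j x < piece (y_ m) i x.
    apply: filter_forall => j; have [->|ji] := eqVneq j i; first by apply: nearW => m.
    by apply: filterS (lt_near j i x (ci j ji)) => m h _.
  by apply: filterS => m h; split.
have [i' ci'] := cells_cover nt.
have ii' : i' != i by apply: contra_notN nci => /eqP <-.
have ltii' : piece y i x < piece y i' x by apply: ci'; rewrite eq_sym.
apply: filterS (lt_near i i' x ltii') => m h; split=> // /(_ i' ii').
by rewrite ltNge (ltW h).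
Unshelve. all: by end_near. Qed.

End Cells.

(** * Cells of equal mass and convex parts of mass [1 / m] *)

Lemma bounded_seq_cluster (R : realType) a b (z : nat -> 'I_a -> 'I_b -> R) :
  (forall m k i, 0 <= z m k i <= 1) ->
  exists y : 'I_a -> 'I_b -> R, forall (e : R) N, 0 < e ->
    exists2 m, (N <= m)%N & forall k i, `|z m k i - y k i| < e.
Proof.
move=> z01; pose v m : 'rV[R]_(a * b) := mxvec (\matrix_(k, i) z m k i).
have cpt := @rV_compact R (a * b) (fun=> `[0, 1]%classic) (fun=> @segment_compact R 0 1).
have [] := cpt (v @ \oo) _.
  exists 0%N => // m _ i /=; case: (mxvec_indexP i) => k j.
  by rewrite /v mxvecE mxE in_itv/= z01.
move=> y [_ ycl]; exists (fun k i => y ord0 (mxvec_index k i)) => e N e0.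
have tail : (v @ \oo) (v @` [set m | (N <= m)%N]) by exists N => // m /= Nm; exists m.
have [w [[m /= Nm <-] ball_w]] := ycl _ _ tail (nbhsx_ballx y e e0).
exists m => // k i; have := ball_w.2 ord0 (mxvec_index k i).
by rewrite /v mxvecE mxE /ball/= distrC.
Qed.

Section PrimePart.
Variables (R : realType) (d n : nat) (mu : 'I_d.+1 -> {measure set (d.-tuple R) -> \bar R}).
Local Notation p := n.+1.
Local Notation q := (d.+1 * p)%N.
Hypotheses (d0 : (0 < d)%N) (ac : forall k, abs_cont (mu k)).
Hypothesis fin : forall k, (mu k setT < +oo)%E.

Definition grid_point (N : nat) (u : 'I_q.+1 -> nat) (k : 'I_d.+1) (i : 'I_p) : R :=
  (u (idx n d.+1 k i))%:R / N%:R.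

Definition mass_label N (k : nat) (u : 'I_q.+1 -> nat) : 'I_p :=
  sel (fun i => fine (mu (inord k) (cell (grid_point N u) i))) (column u).

Lemma mass_label_swap G : (2 <= G)%N ->
  swap_equivariant G (mass_label (p * G.+1).*2.+1).
Proof.
move=> G2 k i u kr lin uf; set N := (p * G.+1).*2.+1.
have G0 : (0 < G)%N by apply: ltn_trans G2.
have [k0 k0r far_k0] := uf.
have gE : grid_point N (u \o block_swap n d.+1 d.+1 i) =
    (fun k' j => grid_point N u k' (adj_swap n i j)).
  by apply/funext => k'; apply/funext => j; rewrite /grid_point /= block_swap_idx// ltn_ord.
have apart : 1 <= (4 * p)%:R *
    `|grid_point N u (Ordinal k0r) (inord i) - grid_point N u (Ordinal k0r) (inord i.+1)|.
  rewrite /grid_point /= !inordK ?ltnS//; last exact: ltnW.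
  rewrite -mulrBl normrM [`|_^-1|]ger0_norm ?invr_ge0// mulrA ler_pdivlMr ?ltr0n// mul1r.
  have absG : G%:R <= `|(u (idx n d.+1 k0 i))%:R - (u (idx n d.+1 k0 i.+1))%:R| :> R.
    case/orP: far_k0; rewrite -(ler_nat R) natrD => h.
      by rewrite distrC; apply: le_trans (ler_norm _); lra.
    by apply: le_trans (ler_norm _); lra.
  (* What remains is [2 * p * (G + 1) + 1 <= 4 * p * G], which holds for [2 <= G]. *)
  apply: le_trans (_ : (4 * p)%:R * G%:R <= _); last by rewrite ler_wpM2l.
  rewrite -natrM ler_nat /N -muln2; nia.
rewrite /mass_label gE column_swap//.
rewrite -[RHS]sel_swap//; last exact: (column_far G0).
by congr sel; apply/funext => j; rewrite /= (cell_swap lin apart).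
Qed.

(** On ever finer grids, small cells have for each measure and each [j] a vertex where cell [j] has
    the largest mass. At a cluster point of these cells the inequalities pass to the limit. *)
Lemma equal_cells : prime p -> exists y : 'I_d.+1 -> 'I_p -> R,
  forall k i j, (mu k (cell y i) <= mu k (cell y j))%E.
Proof.
(* The gap parameter is [G.+3], so that [3 <= G.+3] always holds; [N G] is the number of grid steps
   that belongs to it. *)
move=> pp; pose N G := (p * G.+4).*2.+1.
have N0 G : (0 : R) < (N G)%:R by rewrite ltr0n.
have /choice[u uP] G := rainbow_cell pp (isT : 3 <= G.+3)%N (mass_label_swap (isT : 2 <= G.+3)%N).
pose z G := grid_point (N G) (u G).
have [|y yP] := @bounded_seq_cluster R _ _ z.
  move=> G k i; rewrite /z /grid_point divr_ge0//= ler_pdivrMr// mul1r ler_nat.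
  by have [le _] := uP G; rewrite leqW// le.
exists y => k i j.
(* Half of the error [2 / m.+1] comes from the grid cell, the other half from the distance to the
   cluster point. *)
have near (m : nat) : exists w : 'I_d.+1 -> 'I_p -> R,
    (forall k' i', `|w k' i' - y k' i'| <= 2 / m.+1%:R) /\
    (mu k (cell w i) <= mu k (cell w j))%E.
  have m0 : (0 : R) < m.+1%:R^-1 by rewrite invr_gt0.
  have [G mG zy] := yP _ m m0; have [_ /(_ k j (ltn_ord k))[w ww lab]] := uP G.
  exists (grid_point (N G) w); split=> [k' i'|].
    rewrite -[X in `|X|](subrKA (z G k' i')); apply: le_trans (ler_normD _ _) _.
    rewrite mulr_natl mulr2n; apply: lerD; last exact: ltW.
    rewrite /z /grid_point -mulrBl normrM [`|_^-1|]ger0_norm ?invr_ge0//.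
    have /andP[w1 w2] := ww (idx n d.+1 k' i').
    apply: le_trans (_ : 1 * (N G)%:R^-1 <= _).
      rewrite ler_wpM2r ?invr_ge0// ler_norml.
      move: w1 w2; rewrite -!(ler_nat R) -natr1 => w1 w2.
      by apply/andP; split; lra.
    by rewrite mul1r lef_pV2 ?posrE// ler_nat /N; nia.
  have finm l : mu k (cell (grid_point (N G) w) l) \is a fin_num.
    rewrite ge0_fin_numE//; apply: le_lt_trans (fin k).
    by apply: le_measure; rewrite ?inE//; exact: measurable_cell.
  rewrite -(fineK (finm i)) -(fineK (finm j)) lee_fin.
  have := @sel_max _ _ _ (fun l => fine (mu (inord k) (cell (grid_point (N G) w) l))) (column w) i.
  by rewrite -/(mass_label (N G) k w) lab inord_val.
have [w wP] := choice near.
have wy k' i' : w m k' i' @[m --> \oo] --> y k' i'.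
  apply/cvgrPdist_le => e e0; have e2 : 0 < e / 2 by rewrite divr_gt0.
  apply: filterS (near_infty_natSinv_lt (PosNum e2)) => m /= h.
  by rewrite distrC; apply: le_trans ((wP m).1 k' i') _; rewrite mulrC -ler_pdivlMr// ltW.
have lim l := cell_cvg d0 (@ac k) (i := l) (fin k) wy.
apply: (lee_cvg_to (lim i) (lim j)).
by apply: nearW => m; have [] := wP m.
Qed.

Lemma quadric_concave (s : R) (a : 'I_d -> R) b (x x' : d.-tuple R) (t : R) : s <= 0 -> 0 <= t <= 1 ->
  t * quadric s a b x + (1 - t) * quadric s a b x' <= quadric s a b (cvx_comb t x x').
Proof.
move=> s0 /andP[t0 t1]; rewrite -subr_ge0.
have sq : \sum_i tnth (cvx_comb t x x') i ^+ 2 = t * (\sum_i tnth x i ^+ 2) +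
    (1 - t) * (\sum_i tnth x' i ^+ 2) - t * (1 - t) * (\sum_i (tnth x i - tnth x' i) ^+ 2).
  rewrite !mulr_sumr -big_split -sumrB; apply: eq_bigr => i _.
  by rewrite tnth_mktuple /=; ring.
have lin : \sum_i a i * tnth (cvx_comb t x x') i =
    t * (\sum_i a i * tnth x i) + (1 - t) * (\sum_i a i * tnth x' i).
  rewrite !mulr_sumr -big_split; apply: eq_bigr => i _.
  by rewrite tnth_mktuple /=; ring.
rewrite /quadric sq lin.
have D0 : 0 <= \sum_i (tnth x i - tnth x' i) ^+ 2 by apply: sumr_ge0 => i _; exact: sqr_ge0.
have tt : 0 <= t * (1 - t) by rewrite mulr_ge0// subr_ge0.
have := mulr_ge0 (mulr_ge0 (_ : 0 <= - s) tt) D0; rewrite oppr_ge0 => /(_ s0).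
move: (\sum_i (_ - _) ^+ 2) => D; move: (\sum_i _ ^+ 2) (\sum_i _ ^+ 2) => A A'.
move: (\sum_i _) (\sum_i _) => E E'.
by move=> h; rewrite [X in 0 <= X](_ : _ = - s * (t * (1 - t)) * D)//; ring.
Qed.

Lemma convex_cell y i : (forall j, y ord_max i <= y ord_max j) -> is_convex_set (@cell R d n y i).
Proof.
move=> imin x x' t cx cx' t01 j ji; rewrite -subr_gt0 pieceB.
have yij : y ord_max i - y ord_max j <= 0 by rewrite subr_le0.
apply: lt_le_trans (quadric_concave _ _ x x' yij t01).
rewrite -!pieceB; have := cx j ji; have := cx' j ji; rewrite -![_ < piece y i _]subr_gt0 => h' h.
have /andP[t0 t1] := t01; have [->|tn0] := eqVneq t 0; first by rewrite mul0r add0r subr0 mul1r.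
apply: ltr_pwDl; first by rewrite mulr_gt0// lt_def tn0.
by apply: mulr_ge0; [rewrite subr_ge0|exact: ltW].
Qed.

Theorem prime_part : prime p -> exists C : set (d.-tuple R),
  [/\ measurable C, is_convex_set C & forall k, (p%:R%:E * mu k C = mu k setT)%E].
Proof.
move=> pp; have [y yP] := equal_cells pp.
have [i _ imin] := @Order.TotalTheory.arg_minP _ _ _ (ord0 : 'I_p) xpredT (fun i => y ord_max i) isT.
exists (cell y i); split; first exact: measurable_cell.
  by apply: convex_cell => j; apply: imin.
move=> k; rewrite -(sum_cells d0 (@ac k) y) (eq_bigr (fun=> mu k (cell y i))).
  by rewrite sumr_const card_ord mule_natl.
by move=> j _; apply/eqP; rewrite eq_le !yP.
Qed.

End PrimePart.

(** Induction on [m], with [p] its least prime factor. The restrictions to a part [C0] for [m %/ p]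
    stay finite and absolutely continuous; a part of them for [p], intersected with [C0], is a part
    for [m]. *)
Theorem unit_fraction_part (R : realType) (d m : nat)
    (mu : 'I_d.+1 -> {measure set (d.-tuple R) -> \bar R}) :
  (0 < d)%N -> (0 < m)%N -> (forall k, abs_cont (mu k)) ->
  (forall k, (mu k setT < +oo)%E) -> exists C : set (d.-tuple R),
  [/\ measurable C, is_convex_set C & forall k, (m%:R%:E * mu k C = mu k setT)%E].
Proof.
move=> d0 + ac fin; have [M] := ubnP m; elim: M m => // M IH m mM m0.
have [m1|m1] := leqP m 1%N.
  exists setT; split=> // k; suff -> : m = 1%N by rewrite mul1e.
  by apply/eqP; rewrite eqn_leq m1.
have pp := pdiv_prime m1; set p := pdiv m in pp.
have pm : (p %| m)%N := pdiv_dvd m.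
have p0 := pdiv_gt0 m.
have [||C0 [mC0 C0c C0P]] := IH (m %/ p)%N.
- by rewrite -ltnS; apply: leq_trans mM; rewrite ltnS ltn_Pdiv// prime_gt1.
- by rewrite divn_gt0// dvdn_leq.
have mC0' : measurable C0 by [].
pose nu k : {measure set (d.-tuple R) -> \bar R} := mrestr (mu k) mC0'.
have nuac k : abs_cont (nu k).
  move=> N mN N0; rewrite /nu /= /mrestr; apply/eqP; rewrite eq_le measure_ge0 andbT.
  rewrite -(ac k N mN N0); apply: le_measure; rewrite ?inE//; exact: measurableI.
have nufin k : (nu k setT < +oo)%E.
  rewrite /nu /= /mrestr setTI; apply: le_lt_trans (fin k).
  by apply: le_measure; rewrite ?inE.
have [] := @prime_part R d p.-1 nu d0 nuac nufin; rewrite prednK// => C1 [mC1 C1c C1P].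
exists (C1 `&` C0); split; first exact: measurableI.
  by move=> x y t [? ?] [? ?] t01; split; [apply: C1c|apply: C0c].
move=> k; have := C1P k; rewrite /nu /= /mrestr setTI => E.
by rewrite -(C0P k) -E muleA -EFinM -natrM divnK.
Qed.

(** * Measures on boxes, lines and cubes *)

Section Densities.
Variable R : realType.

(** A bounded density, tested on boxes only. Since null sets are defined by covers with boxes, this
    already yields absolute continuity. *)
Definition box_bounded d (mu : set (d.-tuple R) -> \bar R) : Prop :=
  exists2 K : R, 0 <= K & forall a b, (mu (box a b) <= (K * box_vol a b)%:E)%E.

Lemma measurable_box d (a b : d.-tuple R) : measurable (box a b).
Proof.
rewrite (_ : box a b = \bigcap_(i in [set: 'I_d]) [set x | tnth a i <= tnth x i <= tnth b i]).
  apply: fin_bigcap_measurable => [|i _]; first exact: finite_finset.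
  rewrite (_ : [set x | _] = setT `&` (fun x : d.-tuple R => tnth x i) @^-1` `[tnth a i, tnth b i]).
    by apply: measurable_tnth.
  by apply/seteqP; split => x /=; rewrite in_itv/=; tauto.
by apply/seteqP; split => x /= h i; [move=> _; apply: h|apply: h].
Qed.

Lemma box_bounded_abs_cont d (mu : {measure set (d.-tuple R) -> \bar R}) :
  box_bounded mu -> abs_cont mu.
Proof.
move=> [K K0 Kbox] N mN N0; apply/eqP; rewrite eq_le measure_ge0 andbT.
apply/lee_addgt0Pr => e e0; rewrite add0e.
have eK : 0 < e / (K + 1) by rewrite divr_gt0// ltr_wpDl.
have [a [b [Ncov vol]]] := N0 _ eK.
apply: le_trans (measure_sigma_subadditive mu (fun k => measurable_box (a k) (b k)) mN Ncov) _.
apply: lime_le; first by apply: is_cvg_nneseries => k _ _; exact: measure_ge0.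
apply: nearW => m; apply: (@le_trans _ _ (\sum_(0 <= k < m) (K * box_vol (a k) (b k))%:E)%E).
  by apply: lee_sum => k _; apply: Kbox.
rewrite sumEFin lee_fin big_mkord -mulr_sumr.
apply: le_trans (ler_wpM2l K0 (vol m)) _.
rewrite mulrCA ger_pMr// ler_pdivrMr ?mul1r ?lerDl//; last by rewrite ltr_wpDl.
Qed.

Section UnitMass.
Context (disp : measure_display) (T : measurableType disp) (mu : {measure set T -> \bar R}).

(* An alias of [mu] that can carry a probability structure. *)
Definition unit_mass (mu1 : mu setT = 1%E) : set T -> \bar R := mu.

Hypothesis mu1 : mu setT = 1%E.

HB.instance Definition _ := Measure.copy (unit_mass mu1) mu.
HB.instance Definition _ := Measure_isProbability.Build disp T R (unit_mass mu1) mu1.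

Lemma measure_probability : exists P : probability T R, forall A, P A = mu A.
Proof. by exists (unit_mass mu1). Qed.

End UnitMass.

(** The image of the product measure under [cons_tuple]; the integral is its disintegration over the
    last [n] coordinates. *)
Lemma cons_probability n (P : probability (measurableTypeR R) R) (Q : probability (n.-tuple R) R) :
  exists S : probability (n.+1.-tuple R) R, forall A, measurable A ->
    measurable_fun setT (fun b => P [set z | A (cons_tuple (z : R) b)]) /\
    S A = (\int[Q]_b P [set z | A (cons_tuple (z : R) b)])%E.
Proof.
pose TR : measurableType _ := measurableTypeR R.
pose f (zb : TR * n.-tuple R) : n.+1.-tuple R := cons_tuple (zb.1 : R) zb.2.
have mfst : measurable_fun setT (fun zb : TR * n.-tuple R => zb.1 : R).
  by move=> _ Y mY; apply: (@measurable_fst _ _ TR (n.-tuple R)).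
have mf : measurable_fun setT f by apply: measurable_cons mfst (@measurable_snd _ _ TR (n.-tuple R)).
have [S0 S0E] : exists S0 : {measure set (n.+1.-tuple R) -> \bar R},
    forall A, S0 A = (P \x^ Q)%E (f @^-1` A).
  pose push := (pushforward (P \x^ Q)%E f : {measure set (n.+1.-tuple R) -> \bar R}).
  by exists (push mf).
have S01 : S0 setT = 1%E by rewrite S0E preimage_setT; exact: probability_setT.
have [S SE] := measure_probability S01.
exists S => A mA.
have mfA : measurable (f @^-1` A) by rewrite -[X in measurable X]setTI; exact: mf.
have secE b : ysection (f @^-1` A) b = [set z | A (cons_tuple (z : R) b)].
  by apply/seteqP; split => z /=; rewrite /ysection/= ?inE.
split.
  have := measurable_fun_ysection P mfA.
  by congr measurable_fun; apply/funext => b /=; rewrite secE.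
rewrite SE S0E /product_measure2; apply: eq_integral => b _ /=.
by rewrite secE.
Qed.

Lemma uniform_probE (a b : R) (ab : a < b) (A : set R) : measurable A ->
  uniform_prob ab A = ((b - a)^-1%:E * lebesgue_measure (A `&` `[a, b]))%E.
Proof.
move=> mA; rewrite /uniform_prob integral_uniform_pdf.
rewrite (eq_integral (fun=> (b - a)^-1%:E)); last first.
  by move=> x; rewrite inE/= in_itv/= /uniform_pdf => -[_ ->].
by rewrite integral_cst//=; apply: measurableI.
Qed.

Lemma uniform_prob_itv (a b : R) (ab : a < b) (s t : R) :
  (uniform_prob ab `[s, t] <= ((b - a)^-1 * Num.max 0 (t - s))%:E)%E.
Proof.
have ba : 0 <= (b - a)^-1 by rewrite invr_ge0 subr_ge0 ltW.
rewrite uniform_probE// EFinM lee_wpmul2l ?lee_fin//.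
apply: (@le_trans _ _ (lebesgue_measure `[s, t]%classic)).
  by apply: le_measure; rewrite ?inE//; apply: measurableI.
rewrite lebesgue_measure_itv/= lte_fin; case: ifPn => st.
  by rewrite -EFinD lee_fin le_max lexx orbT.
by rewrite lee_fin le_max lexx.
Qed.

End Densities.

Section Cons.
Variable R : realType.
Local Notation TR := (measurableTypeR R).

Definition fiber n (A : set (n.+1.-tuple R)) (b : n.-tuple R) : set TR :=
  [set z | A (cons_tuple (z : R) b)].

Lemma measurable_fiber n (A : set (n.+1.-tuple R)) b : measurable A -> measurable (fiber A b).
Proof.
move=> mA; pose f (z : TR) : n.+1.-tuple R := cons_tuple (z : R) b.
have mf : measurable_fun setT f.
  apply: (measurable_cons (f := fun z : TR => (z : R)) (g := fun=> b)); last exact: measurable_cst.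
  by move=> _ Y mY; apply: (@measurable_id _ TR).
by rewrite -[X in measurable X]setTI; exact: mf.
Qed.

Definition cons_law n (P : probability TR R) (Q : probability (n.-tuple R) R)
    (S : set (n.+1.-tuple R) -> \bar R) : Prop :=
  forall A, measurable A ->
    measurable_fun setT (fun b => P (fiber A b)) /\ S A = (\int[Q]_b P (fiber A b))%E.

Lemma tnth_lift0 n (x : n.+1.-tuple R) i : tnth x (lift ord0 i) = tnth (behead_tuple x) i.
Proof. by rewrite !(tnth_nth 0) /= nth_behead. Qed.

Definition interval_bounded (P : set TR -> \bar R) : Prop :=
  exists2 K : R, 0 <= K & forall s t : R, (P `[s, t]%classic <= (K * Num.max 0 (t - s))%:E)%E.

Definition rect n (I : set R) (B : set (n.-tuple R)) : set (n.+1.-tuple R) :=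
  [set x | I (thead x) /\ B (behead_tuple x)].

Lemma fiber_rect n (I : set R) (B : set (n.-tuple R)) b :
  fiber (rect I B) b = if b \in B then I else set0.
Proof.
have E z : rect I B (cons_tuple z b) = (I z /\ B b).
  rewrite /rect /= theadE; congr (_ /\ B _).
  by apply: val_inj.
apply/seteqP; split => z; rewrite /fiber /= E.
  by move=> [Iz Bb]; rewrite mem_set.
by case: ifPn => //; rewrite inE => Bb Iz.
Qed.

Lemma measurable_rect n (I : set R) (B : set (n.-tuple R)) :
  measurable I -> measurable B -> measurable (rect I B).
Proof.
move=> mI mB; rewrite (_ : rect I B = (setT `&` (fun x : n.+1.-tuple R => tnth x ord0) @^-1` I) `&`
   (setT `&` (fun x : n.+1.-tuple R => [tuple of behead x]) @^-1` B)).
  by apply: measurableI; [apply: measurable_tnth|apply: measurable_behead].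
by apply/seteqP; split => x /=; rewrite /rect /=; tauto.
Qed.

Lemma cons_law_rect n P Q S (I : set R) (B : set (n.-tuple R)) : cons_law P Q S ->
  measurable I -> measurable B -> S (rect I B) = (P I * Q B)%E.
Proof.
move=> law mI mB; have [_ ->] := law _ (measurable_rect mI mB).
under eq_integral do rewrite fiber_rect.
rewrite (eq_integral (fun b => P I * (\1_B b)%:E)%E); last first.
  by move=> b _; rewrite indicE; case: (b \in B); rewrite ?mule1 ?mule0 ?measure0.
rewrite ge0_integralZl//; last by apply/measurable_EFinP; apply: measurable_indic.
by rewrite integral_indic// setIT.
Qed.

Lemma cons_law_box_bounded n P Q (S : set (n.+1.-tuple R) -> \bar R) : cons_law P Q S ->
  interval_bounded P -> box_bounded Q -> box_bounded S.
Proof.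
move=> law [K1 K10 bP] [K2 K20 bQ]; exists (K1 * K2); first exact: mulr_ge0.
move=> a b; have -> : box a b = rect `[thead a, thead b] (box (behead_tuple a) (behead_tuple b)).
  apply/seteqP; split => x /=.
    move=> h; split; first by rewrite /= in_itv/= /thead; apply: h.
    by move=> i; have := h (lift ord0 i); rewrite !tnth_lift0.
  move=> [/=]; rewrite in_itv/= => h0 h i; case: (unliftP ord0 i) => [j ->|->]; last exact: h0.
  by have := h j; rewrite !tnth_lift0.
rewrite (cons_law_rect law)//; last exact: measurable_box.
have -> : box_vol a b = Num.max 0 (thead b - thead a) * box_vol (behead_tuple a) (behead_tuple b).
  rewrite /box_vol big_ord_recl; congr (_ * _); apply: eq_bigr => i _.
  by rewrite !tnth_lift0.
apply: le_trans (lee_pmul _ _ (bP _ _) (bQ _ _)) _; try exact: measure_ge0.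
by rewrite -EFinM lee_fin mulrACA.
Qed.

Variables (n : nat) (P : probability TR R) (Q : probability (n.-tuple R) R).
Variables (S : set (n.+1.-tuple R) -> \bar R) (B : set (n.-tuple R)).
Hypotheses (law : cons_law P Q S) (mB : measurable B) (QB : Q B = 1%E).

Lemma cons_law_ge (A : set (n.+1.-tuple R)) (t : \bar R) : (0 <= t)%E -> measurable A ->
  (forall b, B b -> t <= P (fiber A b))%E -> (t <= S A)%E.
Proof.
move=> t0 mA h; have [mP ->] := law mA.
rewrite -[leLHS]mule1 -QB -[X in Q X]setIT -integral_indic//.
rewrite -ge0_integralZl//; last by apply/measurable_EFinP; apply: measurable_indic.
apply: ge0_le_integral => //=.
- by move=> b _; rewrite mule_ge0// lee_fin.
- by apply: measurable_funeM; apply/measurable_EFinP; apply: measurable_indic.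
move=> b _; rewrite indicE; have [|_] := boolP (b \in B); last by rewrite mule0.
by rewrite inE mule1; apply: h.
Qed.

Lemma cons_law_le (A : set (n.+1.-tuple R)) (t : \bar R) : (0 <= t)%E -> measurable A ->
  (forall b, B b -> P (fiber A b) <= t)%E -> (S A <= t)%E.
Proof.
move=> t0 mA h; have [mP ->] := law mA.
have QC : Q (~` B) = 0%E by rewrite probability_setC// QB subee.
(* Outside [B] the mass of a fiber is only known to be at most 1, which the second summand provides;
   it integrates to zero. *)
apply: (@le_trans _ _ (\int[Q]_b (t * (\1_B b)%:E + (\1_(~` B) b)%:E))%E).
  apply: ge0_le_integral => //=.
    apply: emeasurable_funD; last by apply/measurable_EFinP; apply: measurable_indic; apply: measurableC.
    by apply: measurable_funeM; apply/measurable_EFinP; apply: measurable_indic.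
  move=> b _; rewrite !indicE in_setC; have [|_] := boolP (b \in B).
    by rewrite inE mule1 adde0; apply: h.
  by rewrite mule0 add0e; apply: probability_le1; apply: measurable_fiber.
rewrite ge0_integralD//; last 3 first.
- by move=> b _; rewrite mule_ge0// lee_fin.
- by apply: measurable_funeM; apply/measurable_EFinP; apply: measurable_indic.
- by apply/measurable_EFinP; apply: measurable_indic; apply: measurableC.
rewrite ge0_integralZl//; last by apply/measurable_EFinP; apply: measurable_indic.
rewrite !integral_indic//; last exact: measurableC.
rewrite [X in (t * X + _)%E](_ : _ = 1%E); last by rewrite setIT; exact: QB.
rewrite [X in (_ + X)%E](_ : _ = 0%E); last by rewrite setIT; exact: QC.
by rewrite mule1 adde0.
Qed.

End Cons.

Section Cubes.
Variable R : realType.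

Definition cube D (c : 'I_D -> R) (h : R) : set (D.-tuple R) :=
  [set b | forall i, c i - h <= tnth b i <= c i + h].

Lemma cubeE D (c : 'I_D -> R) h : cube c h =
  box [tuple c i - h | i < D] [tuple c i + h | i < D].
Proof.
by apply/seteqP; split => b /= cb i; have := cb i; rewrite !tnth_mktuple.
Qed.

Lemma measurable_cube D (c : 'I_D -> R) h : measurable (cube c h).
Proof. by rewrite cubeE; exact: measurable_box. Qed.

Lemma uniform_interval_bounded (a b : R) (ab : a < b) : interval_bounded (uniform_prob ab).
Proof.
exists (b - a)^-1; first by rewrite invr_ge0 subr_ge0 ltW.
exact: uniform_prob_itv.
Qed.

(** One uniform coordinate is added at a time, starting from the point mass in dimension 0. That
    dimension does occur, in the counterexample for [d = 1]. *)
Lemma cube_probability D (c : 'I_D -> R) (h : R) : 0 < h ->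
  exists2 Q : probability (D.-tuple R) R, box_bounded Q & Q (cube c h) = 1%E.
Proof.
move=> h0; elim: D c => [|D IH] c.
  have [|Q QE] := @measure_probability R _ _ (dirac [tuple of [::]] : {measure set (0.-tuple R) -> \bar R}).
    by rewrite /= diracT.
  exists Q; last by rewrite QE /= (_ : cube _ _ = setT) ?diracT//; apply/seteqP; split => // b _ [].
  by exists 1 => // a b; rewrite /box_vol big_ord0 mulr1 probability_le1//; exact: measurable_box.
have [Q bQ Q1] := IH (fun i => c (lift ord0 i)).
have ab : c ord0 - h < c ord0 + h by lra.
have [S law] := cons_probability (uniform_prob ab) Q.
exists S; first exact: cons_law_box_bounded law (uniform_interval_bounded ab) bQ.
have -> : cube c h = rect `[c ord0 - h, c ord0 + h] (cube (fun i => c (lift ord0 i)) h).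
  apply/seteqP; split => x /=.
    move=> hx; split; first by rewrite /= in_itv/= /thead; apply: hx.
    by move=> i; have := hx (lift ord0 i); rewrite !tnth_lift0.
  move=> [/=]; rewrite in_itv/= => hx0 hx i; case: (unliftP ord0 i) => [j ->|->]; last exact: hx0.
  by have := hx j; rewrite !tnth_lift0.
rewrite (cons_law_rect law)//; last exact: measurable_cube.
rewrite Q1 mule1; apply: eq_trans (uniform_probE ab _) _ => //; rewrite setIid lebesgue_measure_itv/= lte_fin ab -EFinD -EFinM.
by rewrite mulVf// gt_eqF// subr_gt0.
Qed.

End Cubes.

Section Line.
Variable R : realType.
Local Notation TR := (measurableTypeR R).

(** Otherwise the part of [A] in the unit interval would lie within distance [L] above its infimum
    and have measure at most [L]. *)
Lemma uniform_prob_gt_pair (A : set R) (L : R) : measurable A -> 0 <= L ->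
  (L%:E < uniform_prob (@ltr01 R) A)%E ->
  exists s t, [/\ A s, A t, 0 <= s, t <= 1 & L < t - s].
Proof.
move=> mA L0; rewrite uniform_probE// subr0 invr1 mul1e => LA.
apply: contrapT => hn.
have {}hn s t : A s -> A t -> 0 <= s -> t <= 1 -> t - s <= L.
  by move=> *; rewrite leNgt; apply/negP => lt; apply: hn; exists s, t.
have [AI0|/set0P[x [Ax]]] := eqVneq (A `&` `[0, 1]) set0.
  by move: LA; rewrite AI0 measure0 lte_fin ltNge L0.
rewrite /= in_itv/= => /andP[x0 x1].
set a := inf (A `&` `[0, 1]).
have lbA : has_inf (A `&` `[0, 1]).
  split; first by exists x; split => //=; rewrite in_itv/= x0.
  by exists 0 => y [_] /=; rewrite in_itv/= => /andP[].
have sub : A `&` `[0, 1] `<=` `[a, a + L]%classic.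
  move=> y [Ay] /=; rewrite !in_itv/= => /andP[y0 y1]; apply/andP; split.
    by apply: ge_inf; [exact: lbA.2|split => //=; rewrite in_itv/= y0].
  rewrite -lerBlDr; apply: lb_le_inf; first exact: lbA.1.
  move=> z [Az] /=; rewrite in_itv/= => /andP[z0 z1].
  by rewrite lerBlDr -lerBlDl; apply: hn.
have : (lebesgue_measure (A `&` `[0%R, 1%R]) <= lebesgue_measure `[a, (a + L)%R])%E.
  by apply: le_measure; rewrite ?inE//; apply: measurableI.
move/(lt_le_trans LA); rewrite lebesgue_measure_itv/= lte_fin; case: ifPn => _; rewrite ?lte_fin.
  by rewrite addrC addKr ltxx.
by rewrite ltNge L0.
Qed.

(** Take the average of [n] uniform laws: a set containing one of the intervals has full mass for
    that summand, whether or not the intervals overlap. *)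
Lemma uniform_mixture (a b : nat -> R) (n : nat) : (0 < n)%N -> (forall j, a j < b j) ->
  exists2 P : probability TR R, interval_bounded P &
    forall j (A : set R), (j < n)%N -> measurable A -> `[a j, b j]%classic `<=` A ->
      ((n%:R^-1)%:E <= P A)%E.
Proof.
move=> n0 ab.
have n0' : 0 < n%:R :> R by rewrite ltr0n.
pose sumU := msum (fun j => uniform_prob (ab j) : {measure set TR -> \bar R}) n.
have sumUE A : sumU A = (\sum_(j < n) uniform_prob (ab j) A)%E by [].
have c0 : 0 <= n%:R^-1 :> R by rewrite invr_ge0 ltW.
pose mix : {measure set TR -> \bar R} := mscale (NngNum c0) sumU.
have mixE A : mix A = ((n%:R^-1)%:E * \sum_(j < n) uniform_prob (ab j) A)%E by [].
have [|P PE] := @measure_probability R _ _ mix.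
  rewrite mixE (eq_bigr (fun=> 1%:E)); last by move=> j _; exact: probability_setT.
  by rewrite sumEFin sumr_const card_ord -EFinM mulVf// gt_eqF.
exists P.
  exists (n%:R^-1 * \sum_(j < n) (b j - a j)^-1).
    by rewrite mulr_ge0// sumr_ge0// => j _; rewrite invr_ge0 subr_ge0 ltW.
  move=> s t; rewrite PE mixE -mulrA EFinM lee_wpmul2l ?lee_fin//.
  rewrite mulr_suml -sumEFin; apply: lee_sum => j _; exact: uniform_prob_itv.
move=> j A jn mA sub; rewrite PE mixE -[leLHS]mule1 lee_wpmul2l ?lee_fin//.
rewrite (bigD1 (Ordinal jn))//= -[leLHS]adde0 leeD//; last first.
  by apply: sume_ge0 => i _; exact: measure_ge0.
rewrite uniform_probE// setIidr// lebesgue_measure_itv/= lte_fin ab -EFinD -EFinM.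
by rewrite mulVf// gt_eqF// subr_gt0.
Qed.

End Line.

(** * Simplices with perturbed vertices *)

Section Geometry.
Variable R : realType.

Lemma convex_sum d (C : set (d.-tuple R)) n (p : 'I_n -> d.-tuple R) (w : 'I_n -> R) :
  is_convex_set C -> (forall i, C (p i)) -> (forall i, 0 <= w i) -> \sum_i w i = 1 ->
  C [tuple \sum_i w i * tnth (p i) k | k < d].
Proof.
move=> cC; elim: n p w => [|n IH] p w Cp w0.
  by rewrite big_ord0 => /eqP; rewrite eq_sym oner_eq0.
rewrite big_ord_recl => w1.
set r := \sum_(i < n) w (lift ord0 i) in w1.
have r0 : 0 <= r by apply: sumr_ge0.
have [r00|rN0] := eqVneq r 0.
  have wl i : w (lift ord0 i) = 0.
    by move/eqP: r00; rewrite psumr_eq0// => /allP/(_ i); rewrite mem_index_enum => /(_ isT)/eqP.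
  rewrite (_ : [tuple _ | k < d] = p ord0)//; apply: eq_from_tnth => k; rewrite tnth_mktuple.
  rewrite big_ord_recl big1 => [|i _]; last by rewrite wl mul0r.
  by move: w1; rewrite r00 !addr0 => ->; rewrite mul1r.
have := IH (fun i => p (lift ord0 i)) (fun i => w (lift ord0 i) / r).
move=> /(_ (fun i => Cp _)) Cr.
have {}Cr := Cr (fun i => divr_ge0 (w0 _) r0) (_ : _ = _).
rewrite -mulr_suml mulfV// in Cr; have {}Cr := Cr erefl.
have w01 : 0 <= w ord0 <= 1 by rewrite w0 -w1 lerDl.
have := cC _ _ _ (Cp ord0) Cr w01.
congr C; apply: eq_from_tnth => k; rewrite !tnth_mktuple big_ord_recl; congr (_ + _).
rewrite -w1 addrC addKr mulr_sumr; apply: eq_bigr => i _.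
by rewrite mulrA mulrCA mulfV// mulr1.
Qed.

Lemma near_identity_mul D (W : 'M[R]_D) (e M : R) (x : 'rV[R]_D) :
  (forall i j, `|W i j - (i == j)%:R| <= e) -> (forall i, `|x 0 i| <= M) ->
  forall j, `|(x *m W) 0 j - x 0 j| <= D%:R * e * M.
Proof.
move=> hW hx j.
have -> : (x *m W) 0 j - x 0 j = \sum_i x 0 i * (W i j - (i == j)%:R).
  under [RHS]eq_bigr do rewrite mulrBr.
  rewrite sumrB mxE; congr (_ - _).
  rewrite (bigD1 j)//= eqxx mulr1 big1 ?addr0// => i /negbTE ->.
  by rewrite mulr0.
apply: le_trans (ler_norm_sum _ _ _) _.
apply: (@le_trans _ _ (\sum_(i < D) e * M)); last first.
  by rewrite sumr_const card_ord -[leLHS]mulr_natl mulrA.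
by apply: ler_sum => i _; rewrite normrM mulrC ler_pM.
Qed.

Lemma row_max_entry D (x : 'rV[R]_D) (j : 'I_D) :
  exists i, forall k, `|x 0 k| <= `|x 0 i|.
Proof.
have [i _ hi] := @arg_maxP _ _ _ j xpredT (fun k => `|x 0 k|) isT.
by exists i => k; apply: hi.
Qed.

(* The vertices [-(1, .., 1), e_1, .., e_D]. *)
Definition simplex_vertex D (i : 'I_D.+1) (k : 'I_D) : R :=
  if unlift ord0 i is Some j then (j == k)%:R else -1.

(** Solve [g *m W = y], where the rows of [W] are the vertices other than the first minus [c], and
    [y] is [c] minus the first vertex. As [W] is close to the identity and [y] to the row of ones,
    [g] exists and is nonnegative; the weights are [1] and [g], normalised. *)
Lemma simplex_weights D (b : 'I_D.+1 -> 'I_D -> R) (c : 'I_D -> R) (h : R) :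
  8%:R * D.+1%:R * h <= 1 ->
  (forall i k, `|b i k - simplex_vertex i k| <= h) -> (forall k, `|c k| <= h) ->
  exists w : 'I_D.+1 -> R, [/\ forall i, 0 <= w i, \sum_i w i = 1 &
    forall k, \sum_i w i * b i k = c k].
Proof.
move=> h1 hb hc.
case: (posnP D) => [D0|D0].
  exists (fun=> 1); split => //; first by rewrite sumr_const card_ord D0.
  by move=> k; move: (ltn_ord k); rewrite {2}D0.
have h0 : 0 <= h by apply: le_trans (hc (Ordinal D0)).
pose W : 'M[R]_D := \matrix_(j, k) (b (lift ord0 j) k - c k).
pose y : 'rV[R]_D := \row_k (c k - b ord0 k).
have Dh : 8%:R * (D%:R * h) + 8%:R * h <= 1 by move: h1; rewrite -natr1; lra.
have Dh0 : 0 <= D%:R * h by rewrite mulr_ge0.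
have hW i j : `|W i j - (i == j)%:R| <= 2%:R * h.
  have := hb (lift ord0 i) j; have := hc j; rewrite mxE /simplex_vertex liftK.
  by rewrite !ler_norml; lra.
have hy j : `|y 0 j - 1| <= 2%:R * h.
  have := hb ord0 j; have := hc j; rewrite mxE /simplex_vertex unlift_none.
  by rewrite !ler_norml; lra.
have uW : W \in unitmx.
  rewrite unitmxE unitfE; apply/det0P => -[v v0 vW].
  have [j vj] : exists j, v 0 j != 0.
    apply/existsP; apply: contraNT v0 => /existsPn hv; apply/eqP/rowP => j.
    by rewrite mxE; apply/eqP; have := hv j; rewrite negbK.
  have [i hi] := row_max_entry v j.
  have := near_identity_mul hW hi i; rewrite vW mxE sub0r normrN.
  have : 0 < `|v 0 i| by apply: lt_le_trans (hi j); rewrite normr_gt0.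
  move: (`|v 0 i|) => m m0; rewrite mulrCA -mulrA; nra.
pose g := y *m invmx W.
have gW : g *m W = y by rewrite /g mulmxKV.
have [i hi] := row_max_entry g (Ordinal D0).
have hg := near_identity_mul hW hi; rewrite gW in hg.
(* From [2 * D * h + 2 * h <= 1 / 4] the largest entry [m] of [g] satisfies [m <= m / 4 + 5 / 4].
   Every entry is then at least [1 - 1 / 4 - 5 / 12]. *)
have m53 : `|g 0 i| <= 5%:R / 3%:R.
  have : `|g 0 i| <= `|y 0 i - g 0 i| + `|y 0 i|.
    by rewrite distrC -{1}[g 0 i](subrK (y 0 i)) ler_normD.
  have : `|y 0 i| <= `|y 0 i - 1| + 1.
    by rewrite -{1}[y 0 i](subrK 1) (le_trans (ler_normD _ _))// normr1.
  have := hg i; have := hy i; move: (normr_ge0 (g 0 i)).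
  move: `|y 0 i - g 0 i| `|y 0 i - 1| `|y 0 i| `|g 0 i| => u v z m; nra.
have g0 j : 0 <= g 0 j.
  have := hg j; have := hy j; move: m53 (normr_ge0 (g 0 i)); move: `|g 0 i| => m m53 m0.
  rewrite !ler_norml => /andP[A _] /andP[_ B]; nra.
have G0 : 0 < 1 + \sum_j g 0 j by rewrite ltr_pwDl// sumr_ge0.
exists (fun i => (if unlift ord0 i is Some j then g 0 j else 1) / (1 + \sum_j g 0 j)); split.
- by move=> j; rewrite divr_ge0// ?(ltW G0)//; case: unliftP.
- rewrite -mulr_suml big_ord_recl unlift_none.
  under eq_bigr do rewrite liftK.
  by rewrite mulfV// gt_eqF.
move=> k; under eq_bigr do rewrite mulrAC.
rewrite -mulr_suml; apply/eqP; rewrite -(inj_eq (mulIf (lt0r_neq0 G0))) mulfVK ?lt0r_neq0//; apply/eqP.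
rewrite big_ord_recl unlift_none mul1r.
under eq_bigr do rewrite liftK.
move/rowP/(_ k): gW; rewrite !mxE.
rewrite (eq_bigr (fun j => g 0 j * b (lift ord0 j) k - g 0 j * c k)); last first.
  by move=> j _; rewrite [W j k]mxE mulrBr.
rewrite sumrB -mulr_suml; lra.
Qed.

End Geometry.

(** * Measures without a common convex part *)

Section Counterexample.
Variable R : realType.
Local Notation TR := (measurableTypeR R).

Lemma fiber_interval n (C : set (n.+1.-tuple R)) (c : n.-tuple R) (s t : R) : is_convex_set C ->
  s < t -> fiber C c s -> fiber C c t -> `[s, t]%classic `<=` fiber C c.
Proof.
move=> cC st Cs Ct z /=; rewrite in_itv/= => /andP[sz zt].
have ts : 0 < t - s by rewrite subr_gt0.
have l01 : 0 <= (t - z) / (t - s) <= 1.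
  by rewrite divr_ge0 ?subr_ge0 ?(ltW st)//= ler_pdivrMr// mul1r lerB.
have := cC _ _ _ Cs Ct l01; rewrite /fiber /=; congr C.
apply: eq_from_tnth => k; rewrite tnth_mktuple.
case: (unliftP ord0 k) => [j ->|->]; rewrite ?tnthS ?tnth0; first by ring.
by field; rewrite gt_eqF.
Qed.

Lemma sum_cons_tuple D n (s w : 'I_n -> R) (b : 'I_n -> D.-tuple R) (c : D.-tuple R) :
  (forall k, \sum_i w i * tnth (b i) k = tnth c k) ->
  [tuple \sum_i w i * tnth (cons_tuple (s i) (b i)) k | k < D.+1] =
  cons_tuple (\sum_i w i * s i) c.
Proof.
move=> hc; apply: eq_from_tnth => k; rewrite tnth_mktuple.
case: (unliftP ord0 k) => [j ->|->]; last by rewrite tnth0; apply: eq_bigr => i _; rewrite tnth0.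
by rewrite tnthS -hc; apply: eq_bigr => i _; rewrite tnthS.
Qed.

Lemma fiber_convex_sum D n (C : set (D.+1.-tuple R)) (s w : 'I_n -> R)
    (b : 'I_n -> D.-tuple R) (c : D.-tuple R) : is_convex_set C ->
  (forall i, 0 <= w i) -> \sum_i w i = 1 -> (forall k, \sum_i w i * tnth (b i) k = tnth c k) ->
  (forall i, fiber C (b i) (s i)) -> fiber C c (\sum_i w i * s i).
Proof.
move=> cC w0 w1 hc Cs; rewrite /fiber /= -(sum_cons_tuple _ hc).
exact: convex_sum.
Qed.

Lemma no_common_part d n (alpha : R) : (0 < d)%N -> (0 < n)%N -> n%:R * alpha < 1 ->
  1 < n.+1%:R * alpha ->
  exists2 mu : 'I_d.+1 -> probability (d.-tuple R) R, (forall i, abs_cont (mu i)) &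
    forall C, measurable C -> is_convex_set C -> ~ forall i, mu i C = alpha%:E.
Proof.
case: d => // D _ n0 na na1.
have n0' : 0 < n%:R :> R by rewrite ltr0n.
have m0' : 0 < n.+1%:R :> R by rewrite ltr0n.
have a1 : alpha < n%:R^-1 by rewrite -[ltRHS]mul1r ltr_pdivlMr// mulrC.
have a0 : n.+1%:R^-1 < alpha by rewrite -[ltLHS]mul1r ltr_pdivrMr// mulrC.
(* [v] has two uses: it is the length of the short intervals, and [L = 1 / n.+1 + v] is a length
   strictly between [1 / n.+1] and [alpha]. *)
pose v := (alpha - n.+1%:R^-1) / 2%:R.
have v0 : 0 < v by rewrite divr_gt0// subr_gt0.
pose L := n.+1%:R^-1 + v.
have L0 : 0 < L by rewrite addr_gt0// invr_gt0.
have La : L < alpha by rewrite /L /v; move: n.+1%:R^-1 a0 => u; lra.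
pose h : R := (8%:R * D.+1%:R)^-1.
have D0 : 0 < 8%:R * D.+1%:R :> R by rewrite mulr_gt0// ltr0n.
have h0 : 0 < h by rewrite invr_gt0.
have hD : 8%:R * D.+1%:R * h <= 1 by rewrite mulfV ?gt_eqF.
have base (P : probability TR R) (c : 'I_D -> R) : interval_bounded P ->
    exists S : probability (D.+1.-tuple R) R, abs_cont S /\
      exists2 Q : probability (D.-tuple R) R, Q (cube c h) = 1%E & cons_law P Q S.
  move=> bP; have [Q bQ Q1] := cube_probability c h0.
  have [S law] := cons_probability P Q; exists S; split; last by exists Q.
  exact: box_bounded_abs_cont (cons_law_box_bounded law bP bQ).
pose a (j : nat) : R := j.+1%:R / n.+1%:R.
have av j : a j < a j + v by rewrite ltrDl.
have [P0 bP0 hP0] := uniform_mixture n0 av.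
have [mu0 [ac0 [Q0 Q01 law0]]] := base P0 (fun=> 0) bP0.
pose U : probability TR R := uniform_prob (@ltr01 R).
have bU : interval_bounded U := uniform_interval_bounded _.
have [mu1 hmu1] := choice (fun i : 'I_D.+1 => base U (simplex_vertex R i) bU).
exists (fun i => if unlift ord0 i is Some j then mu1 j else mu0).
  by move=> i; case: unliftP => [j _|_] //; exact: (hmu1 j).1.
move=> C mC cC hC.
have hC0 : mu0 C = alpha%:E by have := hC ord0; rewrite unlift_none.
have hC1 i : mu1 i C = alpha%:E by have := hC (lift ord0 i); rewrite liftK.
have long i : exists x : D.-tuple R * (R * R), [/\ cube (simplex_vertex R i) h x.1,
    fiber C x.1 x.2.1, fiber C x.1 x.2.2, 0 <= x.2.1 /\ x.2.2 <= 1 & L < x.2.2 - x.2.1].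
  apply: contrapT => hn.
  have [_ [Q Q1 law]] := hmu1 i.
  have : (mu1 i C <= L%:E)%E.
    apply: (cons_law_le law (measurable_cube _ _) Q1) => //; first by rewrite lee_fin ltW.
    move=> b Bb; rewrite leNgt; apply/negP => /uniform_prob_gt_pair.
    case; [exact: measurable_fiber|exact: ltW|] => s [t [Cs Ct s0 t1 Lst]].
    by apply: hn; exists (b, (s, t)).
  by rewrite hC1 lee_fin leNgt La.
have {long} [x hx] := choice long.
have : ((n%:R^-1)%:E <= mu0 C)%E.
  apply: (cons_law_ge law0 (measurable_cube _ _) Q01) => //.
  move=> c cc.
  have [||w [w0 w1 wc]] := @simplex_weights R D (fun i k => tnth (x i).1 k) (tnth c) h hD.
  - by move=> i k; have [/(_ k) + _ _ _ _] := hx i; rewrite ler_norml; lra.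
  - by move=> k; have := cc k; rewrite ler_norml; lra.
  have Cs : fiber C c (\sum_i w i * (x i).2.1).
    by apply: (fiber_convex_sum cC w0 w1 wc) => i; have [] := hx i.
  have Ct : fiber C c (\sum_i w i * (x i).2.2).
    by apply: (fiber_convex_sum cC w0 w1 wc) => i; have [] := hx i.
  have s0 : 0 <= \sum_i w i * (x i).2.1.
    by apply: sumr_ge0 => i _; rewrite mulr_ge0//; have [_ _ _ [-> _]] := hx i.
  have t1 : \sum_i w i * (x i).2.2 <= 1.
    rewrite -w1; apply: ler_sum => i _; rewrite ler_piMr//.
    by have [_ _ _ [_ ->]] := hx i.
  have st : L <= \sum_i w i * (x i).2.2 - \sum_i w i * (x i).2.1.
    rewrite -sumrB -[leLHS]mul1r -w1 mulr_suml; apply: ler_sum => i _.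
    by rewrite -mulrBr ler_wpM2l// ltW//; have [] := hx i.
  move: Cs Ct s0 t1 st; set s := \sum_i _; set t := \sum_i _ => Cs Ct s0 t1 st.
  have ltst : s < t by rewrite -subr_gt0 (lt_le_trans L0).
  have s0' : 0 <= s * n.+1%:R by rewrite mulr_ge0// ltW.
  have /andP[k1 k2] := truncn_itv s0'.
  (* [a k] is the first multiple of [1 / n.+1] above [s]. As [t - s] is at least [1 / n.+1 + v], the
     interval of length [v] starting at [a k] fits below [t <= 1], whence [k < n]. *)
  pose k := Num.truncn (s * n.+1%:R).
  have sa : s <= a k by rewrite ler_pdivlMr// ltW.
  have at_ : a k + v <= t.
    have : a k <= s + n.+1%:R^-1.
      by rewrite /a -natr1 mulrDl mul1r lerD2r ler_pdivrMr.
    by move: st; rewrite /L; move: n.+1%:R^-1 => u; lra.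
  have kn : (k < n)%N.
    rewrite -ltnS -(ltr_nat R) -[ltRHS]mul1r -ltr_pdivrMr//.
    by apply: lt_le_trans (le_trans at_ t1); rewrite ltrDl.
  apply: (hP0 k) => //; first exact: measurable_fiber.
  apply: subset_trans (fiber_interval cC ltst Cs Ct) => z /=; rewrite !in_itv/= => /andP[z1 z2].
  by rewrite (le_trans sa z1) (le_trans z2 at_).
by rewrite hC0 lee_fin leNgt a1.
Qed.

End Counterexample.

Theorem theorem4 (R : realType) (d : nat) (alpha : R) :
  (1 <= d)%N -> 0 < alpha < 1 ->
  ((forall mu : 'I_d.+1 -> probability (d.-tuple R) R,
      (forall i, abs_cont (mu i)) ->
      exists C : set (d.-tuple R),
        measurable C /\ is_convex_set C /\ forall i, mu i C = alpha%:E)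
   <-> exists m : nat, (0 < m)%N /\ alpha = m%:R^-1).
Proof.
move=> d0 /andP[a0 a1]; split=> [common|[m [m0 ->]] mu ac]; last first.
  have [|C [mC cC hC]] := @unit_fraction_part R d m (fun i => mu i) d0 m0 ac.
    by move=> k; rewrite /= probability_setT ltry.
  exists C; split=> //; split=> // i; have := hC i; rewrite /= probability_setT.
  have m0' : m%:R != 0 :> R by rewrite pnatr_eq0 -lt0n.
  rewrite -(@fineK _ (mu i C)) ?fin_num_measure// -EFinM => -[mC1]; congr EFin.
  by apply: (mulfI m0'); rewrite mC1 mulfV.
apply: contrapT => nm.
have ai0 : 0 <= alpha^-1 by rewrite invr_ge0 ltW.
(* [n] is the integer part of [alpha^-1]; equality is excluded because [alpha] is not the inverse of
   a positive integer. *)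
have /andP[] := truncn_itv ai0; move: (Num.truncn _) => n n1 n2.
have n0 : (0 < n)%N.
  rewrite -ltnS -(ltr_nat R); apply: lt_trans n2.
  by rewrite -invr1 ltf_pV2// posrE.
have na : n%:R * alpha < 1.
  rewrite lt_neqAle -ler_pdivlMr// div1r n1 andbT; apply/eqP => na1; apply: nm.
  have nN0 : n%:R != 0 :> R by rewrite pnatr_eq0 -lt0n.
  by exists n; split=> //; apply: (mulfI nN0); rewrite na1 mulfV.
have na1 : 1 < n.+1%:R * alpha by rewrite -ltr_pdivrMr// div1r.
have [mu ac hmu] := no_common_part d0 n0 na na1.
by have [C [mC [cC hC]]] := common mu ac; apply: hmu hC.
Qed.
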